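(* Let $B(x,y,D_x,D_y)$ be a linear partial differential operator with polynomial coefficients on $\mathbb{R}^2$, and let $\sigma=\mathcal{F}^{-1}(e^{-iP(\xi,\eta)})\in\mathcal{S}'(\mathbb{R}^2)$ for some polynomial $P\in\mathbb{R}[\xi,\eta]$. Then, for every $w\in\mathcal{S}(\mathbb{R}^2)$, the time-frequency representation $Q[w]=\sigma*\mathrm{Wig}[w]$ satisfies $$Q[B(M_1,M_2,D_1,D_2)w]=\tilde{B}(M_1,M_2,D_1,D_2)Q[w],$$ where $\tilde{B}$ is the linear partial differential operator with polynomial coefficients defined by $$\tilde{B}(M_1,M_2,D_1,D_2)=B\left(M_1-\tfrac12D_2-P_1,\;M_1+\tfrac12D_2-P_1,\;\tfrac12D_1+M_2-P_2,\;\tfrac12D_1-M_2+P_2\right)$$ with $P_1=(\partial_\xi P)(D_1,D_2)$ and $P_2=(\partial_\eta P)(D_1,D_2)$.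
   Context: Notation. $M_1w(x,y)=xw(x,y)$, $M_2w(x,y)=yw(x,y)$, $D_1=D_x=-i\partial_x$, $D_2=D_y=-i\partial_y$. The Fourier transform is $\mathcal{F}f(\xi,\eta)=\widehat f(\xi,\eta)=\int_{\mathbb{R}^2} e^{-i(x\xi+y\eta)}f(x,y)\,dx\,dy$, extended to $\mathcal{S}'(\mathbb{R}^2)$ as usual. The Wigner-like transform of $w\in\mathcal{S}(\mathbb{R}^2)$ is $$\mathrm{Wig}[w](x,y)=\int_{\mathbb{R}} e^{-ity}\,w\left(x+\tfrac12 t,\,x-\tfrac12 t\right)dt.$$ The convolution satisfies $\widehat{\sigma*f}=\widehat\sigma\cdot\widehat f$. If $B(x,y,\xi,\eta)=\sum c_{mnhk}x^my^n\xi^h\eta^k$ is a polynomial with complex coefficients, the associated linear partial differential operator with polynomial coefficients is $B(x,y,D_x,D_y)=B(M_1,M_2,D_1,D_2)=\sum c_{mnhk}M_1^mM_2^nD_1^hD_2^k$. For operators $X_1,X_2,Y_1,Y_2$, $B(X_1,X_2,Y_1,Y_2)$ means $\sum c_{mnhk}X_1^mX_2^nY_1^hY_2^k$, with factors in this order. $(\partial_\xi P)(D_1,D_2)$ is the constant-coefficient operator obtained by substituting $D_1,D_2$ for $\xi,\eta$ in the polynomial $\partial_\xi P(\xi,\eta)$; similarly for $\partial_\eta P$. *)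

(* Defs.v *)
From HB Require Import structures.
From mathcomp Require Import all_boot all_order all_algebra.
From mathcomp Require Import all_classical all_reals all_analysis.
From mathcomp Require Import complex.
From mathcomp Require mpoly.
Set Implicit Arguments.
Unset Strict Implicit.
Unset Printing Implicit Defensive.
Import Order.TTheory GRing.Theory Num.Theory.
Import numFieldNormedType.Exports.
Import ComplexField.

Local Open Scope classical_set_scope.
Local Open Scope ring_scope.
Local Open Scope complex_scope.

Definition cfun (R : realType) : Type := R * R -> R[i].
Definition cop (R : realType) : Type := cfun R -> cfun R.

(* R[i] carries no normed-module structure over R in the library, so
   derivatives, continuity and integrals are taken componentwise. *)

(* exp(i t) *)
Definition cexpi (R : realType) (t : R) : R[i] := cos t +i* sin t.

Definition cintegral (R : realType) d (T : measurableType d)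
    (mu : {measure set T -> \bar R}) (f : T -> R[i]) : R[i] :=
  Rintegral mu setT (fun t => complex.Re (f t)) +i* Rintegral mu setT (fun t => complex.Im (f t)).

Definition mu1 (R : realType) : {measure set (measurableTypeR R) -> \bar R} :=
  @lebesgue_measure R.

Definition mu2 (R : realType) :
    {measure set (measurableTypeR R * measurableTypeR R) -> \bar R} :=
  (@lebesgue_measure R \x @lebesgue_measure R)%E.

Definition coord (R : realType) (j : 'I_2) (z : R * R) : R :=
  if j == 0 then z.1 else z.2.

Definition set_coord (R : realType) (j : 'I_2) (z : R * R) (t : R) : R * R :=
  if j == 0 then (t, z.2) else (z.1, t).

Definition partial (R : realType) (j : 'I_2) (f : cfun R) : cfun R := fun z =>
  derive1 (fun t => complex.Re (f (set_coord j z t))) (coord j z) +i*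
  derive1 (fun t => complex.Im (f (set_coord j z t))) (coord j z).

Definition has_partial (R : realType) (j : 'I_2) (f : cfun R) (z : R * R) : Prop :=
  derivable (fun t => complex.Re (f (set_coord j z t))) (coord j z) 1 /\
  derivable (fun t => complex.Im (f (set_coord j z t))) (coord j z) 1.

Definition ccontinuous (R : realType) (f : cfun R) : Prop :=
  continuous (fun z => complex.Re (f z)) /\ continuous (fun z => complex.Im (f z)).

(* Iterated partial derivatives along a word s; no order of differentiation
   is privileged. *)
Definition partials (R : realType) (s : seq 'I_2) (f : cfun R) : cfun R :=
  foldr (@partial R) f s.

Definition smooth (R : realType) (f : cfun R) : Prop :=
  forall s : seq 'I_2,
    ccontinuous (partials s f) /\ forall j z, has_partial j (partials s f) z.

Definition weighted (R : realType) (a b : nat) (s : seq 'I_2) (f : cfun R)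
    (z : R * R) : R :=
  Normc.normc ((z.1 ^+ a * z.2 ^+ b)%:C * partials s f z).

Definition schwartz (R : realType) (f : cfun R) : Prop :=
  smooth f /\ forall a b s, exists C : R, forall z, weighted a b s f z <= C.

(* A distribution is represented by a functional of which only the values on
   Schwartz functions are meaningful. *)
Definition functional (R : realType) : Type := cfun R -> R[i].

(* Linearity on S(R^2), and continuity for the Schwartz seminorms: for some N,
   u is bounded by a multiple of the largest seminorm of order at most N. *)
Definition tempered (R : realType) (u : functional R) : Prop :=
  (forall (c : R[i]) (f g : cfun R), schwartz f -> schwartz g ->
     u (fun z => c * f z + g z) = c * u f + u g) /\
  exists (N : nat) (C : R), forall (f : cfun R) (M : R), schwartz f ->
    (forall a b s, (a <= N)%N -> (b <= N)%N -> (size s <= N)%N ->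
       forall z, weighted a b s f z <= M) ->
    Normc.normc (u f) <= C * M.

Definition regular_distr (R : realType) (g : cfun R) : functional R :=
  fun f => cintegral (@mu2 R) (fun z => g z * f z).

Definition fourier (R : realType) (f : cfun R) : cfun R := fun zeta =>
  cintegral (@mu2 R)
    (fun z => cexpi (- (z.1 * zeta.1 + z.2 * zeta.2)) * f z).

Definition inv_fourier (R : realType) (f : cfun R) : cfun R := fun z =>
  ((2 * pi) ^- 2)%:C * fourier f (- z).

(* <F^{-1} u, f> = <u, F^{-1} f>: the kernel of F^{-1} is symmetric. *)
Definition inv_fourier_distr (R : realType) (u : functional R) : functional R :=
  fun f => u (inv_fourier f).

(* (u * f)(z) = <u, f(z - .)> *)
Definition convolution (R : realType) (u : functional R) (f : cfun R) : cfun R :=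
  fun z => u (fun z' => f (z - z')).

Definition Wig (R : realType) (w : cfun R) : cfun R := fun z =>
  cintegral (@mu1 R)
    (fun t => cexpi (- (t * z.2)) * w (z.1 + t / 2, z.1 - t / 2)).

Definition Mop (R : realType) (j : 'I_2) : cop R :=
  fun f z => (coord j z)%:C * f z.

Definition Dop (R : realType) (j : 'I_2) : cop R :=
  fun f z => (0 -i* 1) * partial j f z.

(* X_0^{m_0} X_1^{m_1} ... X_{n-1}^{m_{n-1}}, the last factor acting first. *)
Definition monomial_op (R : realType) (n : nat) (m : mpoly.multinom n)
    (X : n.-tuple (cop R)) : cop R :=
  \big[comp/id]_(i < n) iter (mpoly.fun_of_multinom m i) (tnth X i).

Definition poly_op (R : realType) (n : nat) (p : mpoly.mpoly n R[i])
    (X : n.-tuple (cop R)) : cop R :=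
  fun f z => \sum_(m <- mpoly.msupp p) mpoly.mcoeff m p * monomial_op m X f z.

(* (d_j P)(D_1, D_2) *)
Definition grad_op (R : realType) (P : mpoly.mpoly 2 R) (j : 'I_2) : cop R :=
  poly_op (mpoly.map_mpoly (real_complex R) (mpoly.mderiv j P))
    [tuple Dop 0; Dop 1].

Definition standard_ops (R : realType) : 4.-tuple (cop R) :=
  [tuple Mop 0; Mop 1; Dop 0; Dop 1].

Definition twisted_ops (R : realType) (P : mpoly.mpoly 2 R) : 4.-tuple (cop R) :=
  let P1 := grad_op P 0 in
  let P2 := grad_op P 1 in
  [tuple
    (fun f z => Mop 0 f z - 2^-1 * Dop 1 f z - P1 f z);
    (fun f z => Mop 0 f z + 2^-1 * Dop 1 f z - P1 f z);
    (fun f z => 2^-1 * Dop 0 f z + Mop 1 f z - P2 f z);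
    (fun f z => 2^-1 * Dop 0 f z - Mop 1 f z + P2 f z)].

(* F^{-1}(e^{-iP}) *)
Definition sigma (R : realType) (P : mpoly.mpoly 2 R) : functional R :=
  inv_fourier_distr (regular_distr (fun zeta =>
    cexpi (- mpoly.meval (tnth [tuple zeta.1; zeta.2]) P))).

(* Main.v *)
Require Import Defs.
From mathcomp Require Import all_boot all_order all_algebra.
From mathcomp Require Import all_classical all_reals all_analysis.
From mathcomp Require Import complex.
From mathcomp Require Import measurable_realfun ring lra.
From mathcomp Require mpoly.
Set Implicit Arguments.
Unset Strict Implicit.
Unset Printing Implicit Defensive.
Import Order.TTheory GRing.Theory Num.Theory.
Import numFieldNormedType.Exports.
Import ComplexField Defs.

Local Open Scope classical_set_scope.
Local Open Scope ring_scope.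
Local Open Scope complex_scope.

(* On the Schwartz space, Q[w] = F^{-1}(e^{-iP} F(Wig w)), and every factor maps
   the Schwartz space into itself: F is a composite of two partial Fourier
   transforms, Wig is a partial Fourier transform after a linear substitution,
   and e^{-iP} is a smooth factor of modulus 1 whose derivatives are polynomial
   multiples of itself.  Each factor moves a multiplication or a derivation
   across itself into an explicit operator (F exchanges D_j and M_j,
   multiplication by e^{-iP} turns D_j into D_j + d_j P), so Q intertwines each
   of the four generators with its twisted version, hence every ordered monomial
   in them.  Fourier inversion is never used. *)

(** * Complex-valued functions of a real variable *)

(** The obstacle is that membership in S(R^2) asks for a bound for every weight and every word of
    derivatives. It is met by a coinductive view: S is the largest class of bounded functions stable
    under multiplication by coordinates and partial differentiation, so the rules that move one
    generator across an operator also show that the operator preserves S. Derivatives under the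
    integral sign are handled by inequalities: a bound on second derivatives gives a quadratic
    Taylor remainder with an integrable majorant. Integration by parts is extracted from the
    invariance of Lebesgue measure under reflections. Convolution with sigma takes the form
    F^{-1}(e^{-iP} F V) because F^{-1}, applied to the reflected translate V(z - .), is already a
    character times F V. *)

Section ComplexComponents.
Context {R : realType}.
Implicit Types x y : R[i].

Lemma cReD x y : complex.Re (x + y) = complex.Re x + complex.Re y.
Proof. by case: x; case: y. Qed.
Lemma cImD x y : complex.Im (x + y) = complex.Im x + complex.Im y.
Proof. by case: x; case: y. Qed.
Lemma cReN x : complex.Re (- x) = - complex.Re x.
Proof. by case: x. Qed.
Lemma cImN x : complex.Im (- x) = - complex.Im x.
Proof. by case: x. Qed.
Lemma cReM x y : complex.Re (x * y) =
  complex.Re x * complex.Re y - complex.Im x * complex.Im y.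
Proof. by case: x; case: y. Qed.
Lemma cImM x y : complex.Im (x * y) =
  complex.Re x * complex.Im y + complex.Im x * complex.Re y.
Proof. by case: x => a b; case: y => c d /=; ring. Qed.

Lemma complex_ext x y : complex.Re x = complex.Re y ->
  complex.Im x = complex.Im y -> x = y.
Proof. by case: x => a b; case: y => c d /= -> ->. Qed.

Lemma normc_ge0 x : 0 <= Normc.normc x.
Proof. by case: x => a b; exact: sqrtr_ge0. Qed.
Lemma normc_Re x : `|complex.Re x| <= Normc.normc x.
Proof. by case: x => a b /=; rewrite -sqrtr_sqr ler_wsqrtr// lerDl sqr_ge0. Qed.
Lemma normc_Im x : `|complex.Im x| <= Normc.normc x.
Proof. by case: x => a b /=; rewrite -sqrtr_sqr ler_wsqrtr// lerDr sqr_ge0. Qed.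
Lemma normc_le x : Normc.normc x <= `|complex.Re x| + `|complex.Im x|.
Proof.
case: x => a b /=.
rewrite -[leRHS]ger0_norm ?addr_ge0// -sqrtr_sqr ler_wsqrtr//.
rewrite sqrrD !real_normK ?num_real// -addrA [X in _ <= _ + X]addrC addrA lerDl.
by rewrite mulrn_wge0// mulr_ge0.
Qed.
Lemma normcR (a : R) : Normc.normc a%:C = `|a|.
Proof. by rewrite /= expr0n addr0 sqrtr_sqr. Qed.
Lemma ler_normcD x y : Normc.normc (x + y) <= Normc.normc x + Normc.normc y.
Proof. exact: le_normcD. Qed.
Lemma normc_cexpi (t : R) : Normc.normc (cexpi t) = 1.
Proof. by rewrite /= cos2Dsin2 sqrtr1. Qed.
Lemma cexpiD (s t : R) : cexpi (s + t) = cexpi s * cexpi t.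
Proof. by apply: complex_ext; rewrite ?cReM ?cImM /= ?cosD ?sinD; ring. Qed.
Lemma cexpi0 : cexpi (0 : R) = 1.
Proof. by rewrite /cexpi cos0 sin0. Qed.

End ComplexComponents.

(** * Differentiation and Taylor bounds on the line *)

Section ComplexDerivative.
Context {R : realType}.
Implicit Types (g h : R -> R[i]) (t : R) (d e : R[i]).

Lemma is_derive_addf (f k : R -> R) t (df dk : R) : is_derive t 1 f df ->
  is_derive t 1 k dk -> is_derive t 1 (fun s => f s + k s) (df + dk).
Proof. by move=> fd kd; exact: is_deriveD. Qed.

Lemma is_derive_subf (f k : R -> R) t (df dk : R) : is_derive t 1 f df ->
  is_derive t 1 k dk -> is_derive t 1 (fun s => f s - k s) (df - dk).
Proof. by move=> fd kd; exact: is_deriveB. Qed.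

Lemma is_derive_mulf (f k : R -> R) t (df dk : R) : is_derive t 1 f df ->
  is_derive t 1 k dk ->
  is_derive t 1 (fun s => f s * k s) (df * k t + f t * dk).
Proof.
move=> fd kd; have := is_deriveM fd kd; rewrite /GRing.scale /= => H.
by apply: is_derive_eq H _; ring.
Qed.

Lemma is_derive_compf (f k : R -> R) t (df dk : R) : is_derive (k t) 1 f df ->
  is_derive t 1 k dk -> is_derive t 1 (fun s => f (k s)) (df * dk).
Proof. by move=> fd kd; exact: is_derive1_comp. Qed.

Lemma is_derive_affine (a b t : R) : is_derive t 1 (fun s => a + s * b) b.
Proof.
have := is_derive_addf (is_derive_cst a t 1)
  (is_derive_mulf (is_derive_id t 1) (is_derive_cst b t 1)).
by rewrite mul1r mulr0 addr0 add0r.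
Qed.

(** A relation, so that existence and value of the derivative travel together; [has_partial] and
    [partial] are both read off from it. *)
Definition cderive g t d :=
  is_derive t (1 : R) (fun s => complex.Re (g s)) (complex.Re d) /\
  is_derive t (1 : R) (fun s => complex.Im (g s)) (complex.Im d).

Lemma cderive_cst d t : cderive (fun _ => d) t 0.
Proof. by split; exact: is_derive_cst. Qed.

Lemma cderiveR (f : R -> R) t (df : R) : is_derive t 1 f df ->
  cderive (fun s => (f s)%:C) t df%:C.
Proof. by split => //; exact: is_derive_cst. Qed.

Lemma cderiveD g h t d e : cderive g t d -> cderive h t e ->
  cderive (fun s => g s + h s) t (d + e).
Proof.
move=> [g1 g2] [h1 h2]; split.
  by under eq_fun do rewrite cReD; rewrite cReD; exact: is_derive_addf.
by under eq_fun do rewrite cImD; rewrite cImD; exact: is_derive_addf.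
Qed.

Lemma cderiveM g h t d e : cderive g t d -> cderive h t e ->
  cderive (fun s => g s * h s) t (d * h t + g t * e).
Proof.
move=> [g1 g2] [h1 h2]; split.
  under eq_fun do rewrite cReM.
  apply: is_derive_eq (is_derive_subf (is_derive_mulf g1 h1)
    (is_derive_mulf g2 h2)) _.
  by rewrite cReD !cReM /=; ring.
under eq_fun do rewrite cImM.
apply: is_derive_eq (is_derive_addf (is_derive_mulf g1 h2)
  (is_derive_mulf g2 h1)) _.
by rewrite cImD !cImM /=; ring.
Qed.

Lemma cderiveZ g t d (c : R[i]) : cderive g t d ->
  cderive (fun s => c * g s) t (c * d).
Proof.
by move=> gd; have := cderiveM (cderive_cst c t) gd; rewrite mul0r add0r.
Qed.

Lemma cderive_cexpi (f : R -> R) t (df : R) : is_derive t 1 f df ->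
  cderive (fun s => cexpi (f s)) t ((0 +i* df) * cexpi (f t)).
Proof.
move=> fd; split.
  apply: is_derive_eq (is_derive_compf (is_derive_cos _) fd) _.
  by rewrite cReM /=; ring.
apply: is_derive_eq (is_derive_compf (is_derive_sin _) fd) _.
by rewrite cImM /=; ring.
Qed.

Lemma cderive_comp g (f : R -> R) t d (df : R) : cderive g (f t) d ->
  is_derive t 1 f df -> cderive (fun s => g (f s)) t (df%:C * d).
Proof.
move=> [g1 g2] fd; split.
  apply: is_derive_eq (is_derive_compf g1 fd) _.
  by rewrite cReM /=; ring.
apply: is_derive_eq (is_derive_compf g2 fd) _.
by rewrite cImM /=; ring.
Qed.

Lemma cderive_uniq g t d e : cderive g t d -> cderive g t e -> d = e.
Proof.
move=> [g1 g2] [h1 h2]; apply: complex_ext.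
  by rewrite -(@derive_val _ _ _ _ _ _ _ g1) (@derive_val _ _ _ _ _ _ _ h1).
by rewrite -(@derive_val _ _ _ _ _ _ _ g2) (@derive_val _ _ _ _ _ _ _ h2).
Qed.

(** A remainder bounded by [K * r ^+ 2] can be integrated over a parameter; this turns
    differentiation under an integral sign into an inequality. *)
Lemma is_derive_of_quadratic (f : R -> R) t (df K : R) :
  (forall r : R, `|f (t + r) - f t - r * df| <= K * r ^+ 2) ->
  is_derive t 1 f df.
Proof.
move=> H.
have K0 : 0 <= K.
  by have := H 1; rewrite expr1n mulr1; apply: le_trans.
have lim : (fun h : R => h^-1 *: (f (h + t) - f t)) @ 0^' --> df.
  apply/cvgrPdist_lt => /= e e0.
  (* [K + 1] in the denominator because [K] may be 0. *)
  have e'0 : 0 < e / (K + 1) by rewrite divr_gt0// ltr_wpDl.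
  near=> h.
  have h0 : h != 0 by near: h; exact: nbhs_dnbhs_neq.
  have he : `|h| < e / (K + 1).
    near: h; apply: (@cvg_within _ (nbhs (0:R))).
    apply/nbhs_normP; exists (e / (K + 1)) => //= y /=.
    by rewrite sub0r normrN.
  rewrite -normrN opprB.
  have -> : h^-1 *: (f (h + t) - f t) - df = h^-1 * (f (t + h) - f t - h * df).
    by rewrite /GRing.scale /= (addrC h); field.
  rewrite normrM normfV ltr_pdivrMl ?normr_gt0//.
  apply: (le_lt_trans (H h)); rewrite -(real_normK (num_real h)) expr2 mulrA.
  rewrite [ltRHS]mulrC ltr_pM2r ?normr_gt0//.
  rewrite (@le_lt_trans _ _ ((K + 1) * `|h|)) ?ler_wpM2r ?lerDl//.
  by rewrite -ltr_pdivlMl ?ltr_wpDl// mulrC.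
apply: DeriveDef.
  apply/cvg_ex; exists df; under eq_fun do rewrite scaler1; exact: lim.
by apply: cvg_lim => //; under eq_fun do rewrite scaler1.
Unshelve. all: by end_near. Qed.

Lemma cderive_of_quadratic g t d (K : R) :
  (forall h : R, Normc.normc (g (t + h) - g t - h%:C * d) <= K * h ^+ 2) ->
  cderive g t d.
Proof.
move=> H; split; apply: (@is_derive_of_quadratic _ _ _ K) => h;
  apply: le_trans (H h).
  have := normc_Re (g (t + h) - g t - h%:C * d).
  by rewrite !cReD !cReN cReM /= mul0r subr0.
have := normc_Im (g (t + h) - g t - h%:C * d).
by rewrite !cImD !cImN cImM /= mul0r addr0.
Qed.

Lemma lipschitz_of_derive (f df : R -> R) (K : R) :
  (forall x : R, is_derive x 1 f (df x)) -> (forall x, `|df x| <= K) ->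
  forall x y, `|f y - f x| <= K * `|y - x|.
Proof.
move=> fd fK.
have wlog_lt x y : x <= y -> `|f y - f x| <= K * `|y - x|.
  move=> xy; have [|c _ ->] := MVT_segment xy (df := df) (f := f).
  - apply: derivable_within_continuous => z _.
    by have := fd z; case.
  - by rewrite normrM ler_wpM2r.
move=> x y; case: (leP x y) => [|/ltW] /wlog_lt //.
by rewrite distrC [`|x - y|]distrC.
Qed.

(** The mean value theorem fails for complex values. It is applied to each component and the two
    bounds are added, whence the factor 2. *)
Lemma clipschitz g (dg : R -> R[i]) (K : R) :
  (forall x, cderive g x (dg x)) -> (forall x, Normc.normc (dg x) <= K) ->
  forall x y, Normc.normc (g y - g x) <= 2 * K * `|y - x|.
Proof.
move=> gd gK x y; apply: le_trans (normc_le _) _.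
rewrite mulr_natl mulr2n mulrDl cReD cReN cImD cImN lerD//.
  apply: (@lipschitz_of_derive (fun s => complex.Re (g s))
    (fun s => complex.Re (dg s))) => z; first by case: (gd z).
  exact: le_trans (normc_Re _) (gK z).
apply: (@lipschitz_of_derive (fun s => complex.Im (g s))
  (fun s => complex.Im (dg s))) => z; first by case: (gd z).
exact: le_trans (normc_Im _) (gK z).
Qed.

Lemma taylor1 (f df : R -> R) (K : R) :
  (forall x : R, is_derive x 1 f (df x)) ->
  (forall x y, `|df y - df x| <= K * `|y - x|) ->
  forall x h : R, `|f (x + h) - f x - h * df x| <= K * h ^+ 2.
Proof.
move=> fd fK x h.
(* The linear part is subtracted, so [k 1 - k 0] is the remainder, and the mean value theorem leaves
   an increment of [df] over a distance at most [|h|]. *)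
pose k s := f (x + s * h) - s * (h * df x).
have kd (s : R) : is_derive s 1 k (h * (df (x + s * h) - df x)).
  have H : is_derive s 1 k _ := is_derive_subf
    (is_derive_compf (k := fun r => x + r * h) (fd _) (is_derive_affine x h s))
    (is_derive_mulf (is_derive_id s 1) (is_derive_cst (h * df x) s 1)).
  apply: is_derive_eq H _.
  by rewrite /=; ring.
have [|c] := @MVT_segment _ k (fun s => h * (df (x + s * h) - df x)) 0 1 ler01.
- apply: derivable_within_continuous => z _.
  by have := kd z; case.
rewrite in_itv /= => /andP[c0 c1].
rewrite /k mul1r mul0r addr0 mul0r !subr0 mulr1 mul1r addrAC => ->.
rewrite normrM; apply: (le_trans (ler_wpM2l (normr_ge0 _) (fK _ _))).
rewrite addrAC subrr add0r normrM (ger0_norm c0).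
have K0 : 0 <= K by have := fK 0 1; rewrite subr0 normr1 mulr1; apply: le_trans.
rewrite -[h ^+ 2](real_normK (num_real h)).
have -> : `|h| * (K * (c * `|h|)) = c * (K * `|h| ^+ 2) by ring.
by rewrite ler_piMl// mulr_ge0// exprn_ge0.
Qed.

Lemma ctaylor1 g (dg d2g : R -> R[i]) (K : R) :
  (forall x, cderive g x (dg x)) -> (forall x, cderive dg x (d2g x)) ->
  (forall x, Normc.normc (d2g x) <= K) ->
  forall x h : R,
    Normc.normc (g (x + h) - g x - h%:C * dg x) <= 2 * K * h ^+ 2.
Proof.
move=> gd dgd gK x h; apply: le_trans (normc_le _) _.
rewrite mulr_natl mulr2n mulrDl !cReD !cReN !cImD !cImN cReM cImM /=.
rewrite !mul0r addr0 subr0.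
rewrite lerD//.
  apply: (@taylor1 (fun s => complex.Re (g s)) (fun s => complex.Re (dg s))).
    by move=> z; case: (gd z).
  apply: (@lipschitz_of_derive _ (fun s => complex.Re (d2g s))) => z.
    by case: (dgd z).
  exact: le_trans (normc_Re _) (gK z).
apply: (@taylor1 (fun s => complex.Im (g s)) (fun s => complex.Im (dg s))).
  by move=> z; case: (gd z).
apply: (@lipschitz_of_derive _ (fun s => complex.Im (d2g s))) => z.
  by case: (dgd z).
exact: le_trans (normc_Im _) (gK z).
Qed.

End ComplexDerivative.

(** * The Schwartz space *)

Section PartialDerivatives.
Context {R : realType}.
Implicit Types (f g : cfun R) (z : R * R) (j k : 'I_2).

(** Produces the literal indices 0 and 1, on which [coord] and [set_coord] compute. *)
Lemma ord2P (P : 'I_2 -> Prop) : P 0 -> P 1 -> forall j, P j.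
Proof.
move=> P0 P1 [[|[|//]] i].
  by rewrite (_ : Ordinal i = 0)//; exact: val_inj.
by rewrite (_ : Ordinal i = 1)//; exact: val_inj.
Qed.

Definition pd j f z (d : R[i]) :=
  cderive (fun t => f (set_coord j z t)) (coord j z) d.

Lemma pd_has_partial j f z d : pd j f z d -> has_partial j f z.
Proof. by move=> [[? _] [? _]]; split. Qed.

Lemma partial_pd j f z d : pd j f z d -> partial j f z = d.
Proof.
move=> [d1 d2]; apply: complex_ext; rewrite /= derive1E.
  exact: (@derive_val _ _ _ _ _ _ _ d1).
exact: (@derive_val _ _ _ _ _ _ _ d2).
Qed.

Lemma has_partial_pd j f z : has_partial j f z -> pd j f z (partial j f z).
Proof. by move=> [d1 d2]; split; rewrite /= derive1E; apply: DeriveDef. Qed.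

Lemma set_coord_coord j z : set_coord j z (coord j z) = z.
Proof. by case: z => x y; move: j; apply: ord2P. Qed.

Lemma pd_line j f (g : cfun R) z t : (forall z, pd j f z (g z)) ->
  cderive (fun s => f (set_coord j z s)) t (g (set_coord j z t)).
Proof.
move=> /(_ (set_coord j z t)); rewrite /pd.
by move: j; apply: ord2P => /=.
Qed.

Lemma pd_ext j f z d e : pd j f z d -> d = e -> pd j f z e.
Proof. by move=> ? <-. Qed.

Lemma pdD j f g z d e : pd j f z d -> pd j g z e ->
  pd j (fun z => f z + g z) z (d + e).
Proof. exact: cderiveD. Qed.

Lemma pdM j f g z d e : pd j f z d -> pd j g z e ->
  pd j (fun z => f z * g z) z (d * g z + f z * e).
Proof. by move=> fd gd; have := cderiveM fd gd; rewrite set_coord_coord. Qed.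

Lemma pdZ j f z d (c : R[i]) : pd j f z d -> pd j (fun z => c * f z) z (c * d).
Proof. exact: cderiveZ. Qed.

End PartialDerivatives.

(** * Closure properties of the Schwartz space *)

Section Schwartz.
Context {R : realType}.
Implicit Types (f g : cfun R) (z : R * R) (j k : 'I_2).

Definition bounded f := exists K : R, forall z, Normc.normc (f z) <= K.

(* Continuity needs no separate hypothesis: bounded partial derivatives make a
   function Lipschitz. *)
Lemma ccontinuous_bounded_pd f (g : 'I_2 -> cfun R) :
  (forall j z, pd j f z (g j z)) -> (forall j, bounded (g j)) -> ccontinuous f.
Proof.
move=> fd bd.
have [K0 HK0] := bd 0; have [K1 HK1] := bd 1.
pose K := 2 * K0 + 2 * K1.
have K00 : 0 <= K0 := le_trans (normc_ge0 _) (HK0 (0, 0)).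
have K10 : 0 <= K1 := le_trans (normc_ge0 _) (HK1 (0, 0)).
have lip z z' : Normc.normc (f z' - f z) <= K * `|z' - z|.
  have -> : f z' - f z = (f (z'.1, z'.2) - f (z.1, z'.2)) +
      (f (z.1, z'.2) - f (z.1, z.2)).
    by rewrite addrA subrK; case: z; case: z'.
  apply: le_trans (ler_normcD _ _) _.
  rewrite mulrDl lerD//.
    apply: (@le_trans _ _ (2 * K0 * `|z'.1 - z.1|)).
      apply: (@clipschitz _ (fun s => f (s, z'.2))
        (fun s => g 0 (s, z'.2))) => x.
        exact: (@pd_line _ 0 f (g 0) (x, z'.2)).
      exact: HK0.
    by rewrite ler_wpM2l ?mulr_ge0// prod_normE/= le_max lexx.
  apply: (@le_trans _ _ (2 * K1 * `|z'.2 - z.2|)).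
    apply: (@clipschitz _ (fun s => f (z.1, s)) (fun s => g 1 (z.1, s))) => x.
      exact: (@pd_line _ 1 f (g 1) (z.1, x)).
    exact: HK1.
  by rewrite ler_wpM2l ?mulr_ge0// prod_normE/= le_max lexx orbT.
have K0' : 0 <= K by rewrite /K addr_ge0// mulr_ge0.
have cont (h : R * R -> R) : (forall z z', `|h z' - h z| <= K * `|z' - z|) ->
    continuous h.
  move=> hlip z; apply/cvgrPdist_lt => /= e e0.
  have e'0 : 0 < e / (K + 1) by rewrite divr_gt0// ltr_wpDl.
  near=> z'; rewrite distrC; apply: (le_lt_trans (hlip _ _)).
  have : `|z' - z| < e / (K + 1).
    by rewrite distrC; near: z'; apply: cvgr_dist_lt => //; exact: cvg_id.
  rewrite ltr_pdivlMr ?ltr_wpDl// => H; apply: le_lt_trans H.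
  by rewrite mulrC ler_wpM2l// lerDl.
split; apply: cont => z z'; apply: le_trans (lip z z').
  by rewrite -cReN -cReD; exact: normc_Re.
by rewrite -cImN -cImD; exact: normc_Im.
Unshelve. all: by end_near. Qed.

Lemma iter_Mop a j f z : iter a (Mop j) f z = (coord j z ^+ a)%:C * f z.
Proof.
elim: a => [|a IH] /=; first by rewrite expr0 mul1r.
by rewrite {1}/Mop IH mulrA -rmorphM -exprS.
Qed.

(** Seminorms become sup bounds of words in the generators, the form that a stability argument can
    reach. *)
Lemma weightedE a b s f z :
  weighted a b s f z =
  Normc.normc (iter a (Mop 0) (iter b (Mop 1) (partials s f)) z).
Proof. by rewrite !iter_Mop mulrA -rmorphM. Qed.

(** Coinduction: any class of bounded functions stable under the generators lies in S, since every
    seminorm is the sup of a function still in the class. To show that an operator preserves S, take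
    for [P] the image of S under it; no seminorm has to be expanded. *)
Lemma schwartz_coind (P : cfun R -> Prop) :
  (forall f, P f -> bounded f) ->
  (forall f j, P f -> P (Mop j f)) ->
  (forall f j, P f -> exists2 g, P g & forall z, pd j f z (g z)) ->
  forall f, P f -> schwartz f.
Proof.
move=> Pb PM Pd.
have pE f j : P f -> P (partial j f) /\ forall z, pd j f z (partial j f z).
  move=> Pf; have [g Pg fg] := Pd f j Pf.
  suff -> : partial j f = g by [].
  by apply/funext => z; exact: partial_pd.
have Ps f s : P f -> P (partials s f).
  by move=> Pf; elim: s => //= j s IH; have [] := pE _ j IH.
move=> f Pf; split=> [s|a b s].
  split.
    apply: (@ccontinuous_bounded_pd _ (fun j => partial j (partials s f))).
      by move=> j; have [] := pE _ j (Ps f s Pf).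
    by move=> j; apply: Pb; have [] := pE _ j (Ps f s Pf).
  by move=> j z; have [_ /(_ z)] := pE _ j (Ps f s Pf); exact: pd_has_partial.
have [|K HK] := Pb (iter a (Mop 0) (iter b (Mop 1) (partials s f))).
  have PMi n j g : P g -> P (iter n (Mop j) g).
    by move=> Pg; elim: n => //= n IH; exact: PM.
  by apply: (PMi); apply: (PMi); exact: Ps.
by exists K => z; rewrite weightedE.
Qed.

Lemma schwartz_pd f j z : schwartz f -> pd j f z (partial j f z).
Proof. by case=> /(_ [::]) [_ H] _; exact: has_partial_pd. Qed.

Lemma schwartz_partial f j : schwartz f -> schwartz (partial j f).
Proof.
have E s : partials s (partial j f) = partials (rcons s j) f.
  by rewrite /partials -cats1 foldr_cat.
move=> [Sf Wf]; split=> [s|a b s]; first by rewrite E.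
have [K HK] := Wf a b (rcons s j).
by exists K => z; move: (HK z); rewrite /weighted E.
Qed.

Lemma schwartz_weighted f a b : schwartz f ->
  bounded (fun z => (z.1 ^+ a * z.2 ^+ b)%:C * f z).
Proof. by case=> _ /(_ a b [::]). Qed.

Lemma schwartz_bounded f : schwartz f -> bounded f.
Proof.
move=> /schwartz_weighted-/(_ 0%N 0%N) [K HK]; exists K => z.
by have := HK z; rewrite !expr0 mul1r mul1r.
Qed.

(** The invariant for [schwartz_coind] that yields stability of S under sums, scalars and
    coordinates. By the Leibniz rule the derivative of x^a y^b f is a combination of products of the
    same kind, so the class has to be a linear span. *)
Inductive schwartz_span : cfun R -> Prop :=
| schwartz_span_mono a b f : schwartz f ->
    schwartz_span (fun z => (z.1 ^+ a * z.2 ^+ b)%:C * f z)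
| schwartz_spanD f g : schwartz_span f -> schwartz_span g ->
    schwartz_span (fun z => f z + g z)
| schwartz_spanZ c f : schwartz_span f -> schwartz_span (fun z => c * f z).

(** For exponent 0 the predecessor is again 0, and the factor [0%:R] makes the term vanish. *)
Lemma pd_monomial a b j z :
  pd j (fun z => (z.1 ^+ a * z.2 ^+ b)%:C) z
    (if j == 0 then a%:R * (z.1 ^+ a.-1 * z.2 ^+ b)%:C
     else b%:R * (z.1 ^+ a * z.2 ^+ b.-1)%:C).
Proof.
have natC n : (n%:R : R[i]) = (n%:R : R)%:C by rewrite rmorph_nat.
have dX n (t : R) : is_derive t 1 (fun s => s ^+ n) (n%:R * t ^+ n.-1).
  elim: n => [|n IH]; first by rewrite mul0r; exact: is_derive_cst.
  under eq_fun do rewrite exprS.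
  have H : is_derive t 1 (fun s : R => s * s ^+ n) _ :=
    is_derive_mulf (is_derive_id t 1) IH.
  apply: is_derive_eq H _; rewrite mul1r mulrCA /=.
  case: n {IH} => [|n]; first by rewrite mul0r addr0 mul1r.
  by rewrite -exprS -[n.+2]addn1 natrD /=; ring.
move: j; apply: ord2P => /=; rewrite natC -rmorphM; apply: cderiveR => /=.
  have H : is_derive z.1 (1 : R) (fun s : R => s ^+ a * z.2 ^+ b) _ :=
    is_derive_mulf (dX a _) (is_derive_cst (z.2 ^+ b) _ (1 : R)).
  by apply: is_derive_eq H _; rewrite /cst /=; ring.
have H : is_derive z.2 (1 : R) (fun s : R => z.1 ^+ a * s ^+ b) _ :=
  is_derive_mulf (is_derive_cst (z.1 ^+ a) _ (1 : R)) (dX b _).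
by apply: is_derive_eq H _; rewrite /cst /=; ring.
Qed.

Lemma schwartz_of_span f : schwartz_span f -> schwartz f.
Proof.
apply: schwartz_coind f => [f|f j|f j].
- elim=> [a b g /schwartz_weighted //|{}f g _ [K HK] _ [L HL]|c {}f _ [K HK]].
    exists (K + L) => z; apply: le_trans (ler_normcD _ _) _.
    by rewrite lerD.
  exists (Normc.normc c * K) => z.
  by rewrite Normc.normcM ler_wpM2l ?normc_ge0.
- elim=> [a b g Sg|{}f g _ If _ Ig|c {}f _ If].
  + move: j; apply: ord2P.
      rewrite (_ : Mop _ _ = fun z => (z.1 ^+ a.+1 * z.2 ^+ b)%:C * g z).
        exact: schwartz_span_mono.
      by apply/funext => z; rewrite /Mop mulrA -rmorphM mulrA -exprS.
    rewrite (_ : Mop _ _ = fun z => (z.1 ^+ a * z.2 ^+ b.+1)%:C * g z).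
      exact: schwartz_span_mono.
    by apply/funext => z; rewrite /Mop mulrA -rmorphM mulrCA -exprS.
  + rewrite (_ : Mop _ _ = fun z => Mop j f z + Mop j g z).
      exact: schwartz_spanD.
    by apply/funext => z; rewrite /Mop mulrDr.
  + rewrite (_ : Mop _ _ = fun z => c * Mop j f z).
      exact: schwartz_spanZ.
    by apply/funext => z; rewrite /Mop mulrCA.
- elim=> [a b g Sg|{}f g _ [f' Sf' Hf] _ [g' Sg' Hg]|c {}f _ [f' Sf' Hf]].
  + exists (fun z => (if j == 0 then a%:R else b%:R) *
        ((if j == 0 then z.1 ^+ a.-1 * z.2 ^+ b
          else z.1 ^+ a * z.2 ^+ b.-1)%:C * g z) +
      (z.1 ^+ a * z.2 ^+ b)%:C * partial j g z).
      apply: schwartz_spanD; last first.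
        by apply: schwartz_span_mono; exact: schwartz_partial.
      by apply: schwartz_spanZ; case: (j == 0); exact: schwartz_span_mono.
    move=> z; apply: pd_ext.
      exact: pdM (pd_monomial a b j z) (schwartz_pd j z Sg).
    by congr (_ + _); case: (j == 0); rewrite mulrA.
  + exists (fun z => f' z + g' z); first exact: schwartz_spanD.
    by move=> z; exact: pdD.
  + exists (fun z => c * f' z); first exact: schwartz_spanZ.
    by move=> z; exact: pdZ.
Qed.

Lemma schwartz_mono a b f : schwartz f ->
  schwartz (fun z => (z.1 ^+ a * z.2 ^+ b)%:C * f z).
Proof. by move=> Sf; apply: schwartz_of_span; exact: schwartz_span_mono. Qed.

Lemma schwartz_sub_span f : schwartz f -> schwartz_span f.
Proof.
move=> Sf; have := schwartz_span_mono 0 0 Sf.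
by congr schwartz_span; apply/funext => z; rewrite !expr0 mul1r mul1r.
Qed.

Lemma schwartzD f g : schwartz f -> schwartz g -> schwartz (fun z => f z + g z).
Proof.
move=> Sf Sg; apply: schwartz_of_span.
by apply: schwartz_spanD; exact: schwartz_sub_span.
Qed.

Lemma schwartzZ c f : schwartz f -> schwartz (fun z => c * f z).
Proof.
move=> Sf; apply: schwartz_of_span.
by apply: schwartz_spanZ; exact: schwartz_sub_span.
Qed.

Lemma schwartz_Mop j f : schwartz f -> schwartz (Mop j f).
Proof.
move=> Sf; move: j; apply: ord2P.
  have := schwartz_mono 1 0 Sf; congr schwartz; apply/funext => z.
  by rewrite expr1 expr0 mulr1.
have := schwartz_mono 0 1 Sf; congr schwartz; apply/funext => z.
by rewrite expr1 expr0 mul1r.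
Qed.

Lemma schwartz_Dop j f : schwartz f -> schwartz (Dop j f).
Proof. by move=> Sf; apply: schwartzZ; exact: schwartz_partial. Qed.

End Schwartz.

(** * Substitutions and factors preserving the Schwartz space *)

Section AffineSubstitution.
Context {R : realType}.
Implicit Types (f g : cfun R) (z : R * R) (j k : 'I_2).

(** The definition of S speaks of derivatives along the axes only. The chain rule along an oblique
    line comes from the bounds on second derivatives, through an explicit quadratic remainder. *)
Lemma schwartz_cderive_line f (x y u v t : R) : schwartz f ->
  cderive (fun s => f (x + s * u, y + s * v)) t
    (u%:C * partial 0 f (x + t * u, y + t * v) +
     v%:C * partial 1 f (x + t * u, y + t * v)).
Proof.
move=> Sf.
have S0 := schwartz_partial 0 Sf; have S1 := schwartz_partial 1 Sf.
have [K00 H00] := schwartz_bounded (schwartz_partial 0 S0).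
have [K01 H01] := schwartz_bounded (schwartz_partial 1 S0).
have [K11 H11] := schwartz_bounded (schwartz_partial 1 S1).
apply: (@cderive_of_quadratic _ _ _ _
  (2 * K00 * u ^+ 2 + 2 * K01 * (`|u| * `|v|) + 2 * K11 * v ^+ 2)) => h.
have -> : x + (t + h) * u = x + t * u + h * u by ring.
have -> : y + (t + h) * v = y + t * v + h * v by ring.
move: (x + t * u) (y + t * v) => {x y}x y.
(* Three errors of order h^2: the horizontal Taylor remainder at height [y + h * v], the variation
   of [partial 0 f] between the two heights, and the vertical Taylor remainder at [x]. *)
have -> : f (x + h * u, y + h * v) - f (x, y) -
    h%:C * (u%:C * partial 0 f (x, y) + v%:C * partial 1 f (x, y)) =
  (f (x + h * u, y + h * v) - f (x, y + h * v) -
     (h * u)%:C * partial 0 f (x, y + h * v)) +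
  (h * u)%:C * (partial 0 f (x, y + h * v) - partial 0 f (x, y)) +
  (f (x, y + h * v) - f (x, y) - (h * v)%:C * partial 1 f (x, y)).
  by rewrite !rmorphM /=; ring.
apply: le_trans (ler_normcD _ _) _; rewrite 2!mulrDl.
apply: lerD; [apply: le_trans (ler_normcD _ _) _; apply: lerD|].
- rewrite -mulrA -exprMn mulrC [u * h]mulrC mulrC.
  apply: (@ctaylor1 _ (fun s => f (s, y + h * v))
    (fun s => partial 0 f (s, y + h * v))
    (fun s => partial 0 (partial 0 f) (s, y + h * v))) => r.
  + exact: (@schwartz_pd _ f 0 (r, y + h * v)).
  + exact: (@schwartz_pd _ (partial 0 f) 0 (r, y + h * v)).
  + exact: H00.
- rewrite Normc.normcM normcR normrM.
  have L : Normc.normc (partial 0 f (x, y + h * v) - partial 0 f (x, y)) <=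
      2 * K01 * `|h * v|.
    rewrite -[X in `|X|](addrK y) [h * v + y]addrC.
    apply: (@clipschitz _ (fun s => partial 0 f (x, s))
      (fun s => partial 1 (partial 0 f) (x, s))) => r.
      exact: (@schwartz_pd _ (partial 0 f) 1 (x, r)).
    exact: H01.
  apply: le_trans (ler_wpM2l _ L) _; first by rewrite mulr_ge0.
  rewrite normrM -[h ^+ 2](real_normK (num_real h)) le_eqVlt.
  by apply/orP; left; apply/eqP; ring.
- rewrite -mulrA -exprMn mulrC [v * h]mulrC mulrC.
  apply: (@ctaylor1 _ (fun s => f (x, s)) (fun s => partial 1 f (x, s))
    (fun s => partial 1 (partial 1 f) (x, s))) => r.
  + exact: (@schwartz_pd _ f 1 (x, r)).
  + exact: (@schwartz_pd _ (partial 1 f) 1 (x, r)).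
  + exact: H11.
Qed.

Section affine.
Variables a b p c d q : R.
Let A z : R * R := (p + z.1 * a + z.2 * b, q + z.1 * c + z.2 * d).

Lemma pd_affine f z : schwartz f ->
  pd 0 (f \o A) z (a%:C * partial 0 f (A z) + c%:C * partial 1 f (A z)) /\
  pd 1 (f \o A) z (b%:C * partial 0 f (A z) + d%:C * partial 1 f (A z)).
Proof.
move=> Sf; rewrite /pd /A /=; split.
  rewrite (_ : (fun t => _) = (fun s =>
      f ((p + z.2 * b) + s * a, (q + z.2 * d) + s * c))); last first.
    by apply/funext => s /=; rewrite addrAC [_ + _ + z.2 * d]addrAC.
  by rewrite addrAC [_ + _ + z.2 * d]addrAC; exact: schwartz_cderive_line.
exact: (@schwartz_cderive_line _ (p + z.1 * a) (q + z.1 * c)).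
Qed.

(** Differentiation is the chain rule. For multiplication by a coordinate, invertibility of the
    linear part writes the coordinate of z as an affine function of [A z]. *)
Lemma schwartz_affine f : a * d - b * c != 0 -> schwartz f -> schwartz (f \o A).
Proof.
move=> D0 Sf.
apply: (@schwartz_coind _ (fun g => exists2 f, schwartz f & g = f \o A)).
- move=> _ [{Sf}f Sf ->]; have [K HK] := schwartz_bounded Sf.
  by exists K => z; exact: HK.
- move=> _ j [{Sf}f Sf ->].
  (* Row j of the adjugate matrix: Cramer's rule solves [A z] for coordinate j. *)
  pose s0 := if j == 0 then d else - c; pose s1 := if j == 0 then - b else a.
  pose D := a * d - b * c.
  exists (fun w => (s0 / D)%:C * Mop 0 f w + ((s1 / D)%:C * Mop 1 f w +
    (- (s0 * p + s1 * q) / D)%:C * f w)).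
    by apply: schwartzD; [|apply: schwartzD]; apply: schwartzZ;
      do ?exact: schwartz_Mop.
  apply/funext => z; rewrite /Mop /= !mulrA -!rmorphM -!mulrDl -!rmorphD.
  congr (_%:C * _); rewrite /s0 /s1 /A /D; move: j {s0 s1}.
  by apply: ord2P; rewrite /Defs.coord /=; field.
- move=> _ j [{Sf}f Sf ->].
  (* Column j of the matrix, the direction in which [A z] moves with coordinate j. *)
  pose s0 := if j == 0 then a else b; pose s1 := if j == 0 then c else d.
  exists ((fun w => s0%:C * partial 0 f w + s1%:C * partial 1 f w) \o A).
    eexists; last by [].
    by apply: schwartzD; apply: schwartzZ; exact: schwartz_partial.
  move=> z; have [H0 H1] := pd_affine z Sf.
  by rewrite /s0 /s1; move: j {s0 s1}; apply: ord2P.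
- by exists f.
Qed.

End affine.

(** The logarithmic derivatives [g j] multiply S into itself, so a derivative of [e * f] is again
    [e] times a Schwartz function, and modulus 1 gives boundedness. Serves both the characters and
    the phase e^{-iP}. *)
Lemma schwartz_mul_unimodular (e : cfun R) (g : 'I_2 -> cfun R) f :
  (forall z, Normc.normc (e z) = 1) ->
  (forall j z, pd j e z (g j z * e z)) ->
  (forall j f, schwartz f -> schwartz (fun z => g j z * f z)) ->
  schwartz f -> schwartz (fun z => e z * f z).
Proof.
move=> e1 ed gS Sf.
apply: (@schwartz_coind _
  (fun h => exists2 f, schwartz f & h = fun z => e z * f z)).
- move=> _ [{Sf}f Sf ->]; have [K HK] := schwartz_bounded Sf.
  by exists K => z; rewrite Normc.normcM e1 mul1r.
- move=> _ j [{Sf}f Sf ->]; exists (Mop j f); first exact: schwartz_Mop.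
  by apply/funext => z; rewrite /Mop mulrCA.
- move=> _ j [{Sf}f Sf ->].
  exists (fun z => e z * (g j z * f z + partial j f z)).
    eexists; last by [].
    by apply: schwartzD; [exact: gS|exact: schwartz_partial].
  move=> z; apply: pd_ext; first exact: pdM (ed j z) (schwartz_pd j z Sf).
  ring.
- by exists f.
Qed.

End AffineSubstitution.

(** * Integrals of Schwartz functions *)

Section ProductMeasurability.
Context {R : realType}.

(** An open set is the union of the rational boxes it contains, a countable family, hence belongs to
    the product sigma-algebra that carries [mu2]. *)
Lemma open_measurable_prod (O : set (R * R)) : open O ->
  measurable (O : set (measurableTypeR R * measurableTypeR R)).
Proof.
move=> oO.
pose box (q : (rat * rat) * (rat * rat)) : set (R * R) :=
  `]ratr q.1.1, ratr q.1.2[%classic `*` `]ratr q.2.1, ratr q.2.2[%classic.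
have -> : O = \bigcup_q (if `[< box q `<=` O >] then box q else set0).
  apply/seteqP; split => [[x y] Oxy|z [q _]]; last first.
    by case: ifPn => // /asboolP; apply.
  have [[A B] /= [nA nB] AB] := open_nbhs_nbhs (conj oO Oxy).
  have [e1 /= e10 HA] := nA; have [e2 /= e20 HB] := nB.
  have near_rat (u e : R) : 0 < e -> exists2 q : rat * rat,
      `]ratr q.1, ratr q.2[%classic u &
      forall v, `]ratr q.1, ratr q.2[%classic v -> ball u e v.
    move=> e0.
    have /rat_in_itvoo[q1] : u - e < u by rewrite ltrBlDr ltrDl.
    have /rat_in_itvoo[q2] : u < u + e by rewrite ltrDl.
    rewrite !in_itv/= => /andP[uq2 q2e] /andP[eq1 q1u].
    exists (q1, q2) => /= [|v]; rewrite in_itv/= ?q1u//.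
    move=> /andP[q1v vq2]; rewrite /ball/= ltr_distlC; apply/andP; split.
      exact: lt_trans q1v.
    exact: lt_trans vq2 _.
  have [q1 q1x Hq1] := near_rat x e1 e10.
  have [q2 q2y Hq2] := near_rat y e2 e20.
  exists (q1, q2) => //.
  rewrite ifT; first by split.
  apply/asboolP => -[x' y'] [/= /Hq1 Bx /Hq2 By]; apply: AB; split => /=.
    exact: HA.
  exact: HB.
apply: countable_bigcupT_measurable => // q.
by case: ifP => // _; apply: measurableX; exact: measurable_itv.
Qed.

Lemma continuous_measurable_prod (h : R * R -> R) : continuous h ->
  measurable_fun setT (h : measurableTypeR R * measurableTypeR R -> R).
Proof.
move=> ch.
apply: (measurability _ (measurable_realfun.RGenOInfty.measurableE R)) => //=.
move=> _ [_ [x ->] <-]; rewrite setTI; apply: open_measurable_prod.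
by move/continuousP : ch; apply; exact: interval_open.
Qed.

End ProductMeasurability.

(** * Componentwise integration of complex functions *)

Section ComplexIntegral.
Context {R : realType} d {T : measurableType d}.
Context {mu : {measure set T -> \bar R}}.
Implicit Types (f g : T -> R[i]) (b : T -> R).

Definition cintegrable f :=
  mu.-integrable setT (fun t => (complex.Re (f t))%:E) /\
  mu.-integrable setT (fun t => (complex.Im (f t))%:E).

Lemma cintegrable_dominated f b :
  measurable_fun setT (fun t => complex.Re (f t)) ->
  measurable_fun setT (fun t => complex.Im (f t)) ->
  mu.-integrable setT (EFin \o b) ->
  (forall t, Normc.normc (f t) <= b t) -> cintegrable f.
Proof.
move=> mR mI ib fb; split; apply: (le_integrable measurableT _ _ ib) => //.
- exact/measurable_EFinP.
- move=> t _; rewrite lee_fin; apply: le_trans (normc_Re _) _.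
  exact: le_trans (fb t) (ler_norm _).
- exact/measurable_EFinP.
- move=> t _; rewrite lee_fin; apply: le_trans (normc_Im _) _.
  exact: le_trans (fb t) (ler_norm _).
Qed.

Lemma cintegralD f g : cintegrable f -> cintegrable g ->
  cintegral mu (fun t => f t + g t) = cintegral mu f + cintegral mu g.
Proof.
move=> [f1 f2] [g1 g2]; apply: complex_ext; rewrite ?cReD ?cImD /=.
  by under eq_Rintegral do rewrite cReD; rewrite RintegralD.
by under eq_Rintegral do rewrite cImD; rewrite RintegralD.
Qed.

Lemma cintegrableD f g : cintegrable f -> cintegrable g ->
  cintegrable (fun t => f t + g t).
Proof.
move=> [f1 f2] [g1 g2]; split.
  under eq_fun do rewrite cReD EFinD; exact: integrableD.
under eq_fun do rewrite cImD EFinD; exact: integrableD.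
Qed.

Lemma integrableZ_EFin (c : R) (h : T -> R) :
  mu.-integrable setT (fun t => (h t)%:E) ->
  mu.-integrable setT (fun t => (c * h t)%:E).
Proof.
by under [in X in _ -> X]eq_fun do rewrite EFinM; exact: integrableZl.
Qed.

Lemma cintegrableZ f (c : R[i]) : cintegrable f ->
  cintegrable (fun t => c * f t).
Proof.
move=> [f1 f2]; split.
  under eq_fun do rewrite cReM EFinB.
  by apply: integrableB => //; exact: integrableZ_EFin.
under eq_fun do rewrite cImM EFinD.
by apply: integrableD => //; exact: integrableZ_EFin.
Qed.

Lemma cintegralZ f (c : R[i]) : cintegrable f ->
  cintegral mu (fun t => c * f t) = c * cintegral mu f.
Proof.
move=> [f1 f2]; apply: complex_ext; rewrite ?cReM ?cImM /=.
  under eq_Rintegral do rewrite cReM.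
  by rewrite RintegralB ?RintegralZl//; exact: integrableZ_EFin.
under eq_Rintegral do rewrite cImM.
by rewrite RintegralD ?RintegralZl//; exact: integrableZ_EFin.
Qed.

Lemma cintegrableB f g : cintegrable f -> cintegrable g ->
  cintegrable (fun t => f t - g t).
Proof.
move=> fi gi; have := cintegrableD fi (cintegrableZ (-1) gi).
by congr cintegrable; apply/funext => t; rewrite mulN1r.
Qed.

Lemma cintegralB f g : cintegrable f -> cintegrable g ->
  cintegral mu (fun t => f t - g t) = cintegral mu f - cintegral mu g.
Proof.
move=> fi gi; rewrite -[RHS]/(_ + _) -mulN1r -cintegralZ// -cintegralD//.
  by congr cintegral; apply/funext => t; rewrite mulN1r.
exact: cintegrableZ.
Qed.

Lemma normc_cintegral_le f b : cintegrable f ->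
  mu.-integrable setT (EFin \o b) ->
  (forall t, Normc.normc (f t) <= b t) ->
  Normc.normc (cintegral mu f) <= 2 * \int[mu]_t b t.
Proof.
move=> [f1 f2] ib fb; apply: le_trans (normc_le _) _ => /=.
rewrite mulr_natl mulr2n.
apply: lerD; apply: le_trans (le_normr_Rintegral _ _) _ => //.
  apply: le_Rintegral => // [|t _]; last exact: le_trans (normc_Re _) (fb t).
  exact: (integrable_abse f1).
apply: le_Rintegral => // [|t _]; last exact: le_trans (normc_Im _) (fb t).
exact: (integrable_abse f2).
Qed.

End ComplexIntegral.
Arguments cintegrable {R d T} mu f.

(** * Invariance of Lebesgue measure under reflections *)

Section LebesgueReflection.
Context {R : realType}.
Local Notation mu := (@mu1 R).

(** By uniqueness of Lebesgue measure it suffices to test intervals []a, b]], whose preimage [[c -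
    b, c - a[] has the same length. *)
Lemma lebesgue_measure_reflect (c : R) (A : set R) : measurable A ->
  pushforward mu ((fun t => c - t) : measurableTypeR R -> measurableTypeR R) A
  = mu A.
Proof.
have mc : measurable_fun setT
    ((fun t => c - t) : measurableTypeR R -> measurableTypeR R).
  by apply: measurable_funB => //; exact: measurable_cst.
move=> mA; apply/esym/lebesgue_measure_unique => //= _ [[a b]] _ <-.
rewrite /pushforward.
have -> : (fun t => c - t) @^-1` `]a, b] = `[c - b, c - a[%classic.
  apply/seteqP; split => t /=; rewrite !in_itv/= => /andP[? ?];
    apply/andP; split; lra.
rewrite /mu1 !lebesgue_measure_itv/= !lte_fin ltrD2l ltrN2.
by case: ifP => // _; rewrite -!EFinD; congr (_%:E); ring.
Qed.

Lemma Rintegral_reflect (c : R) (h : R -> R) :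
  measurable_fun setT (h : measurableTypeR R -> R) ->
  mu.-integrable setT (fun t => (h (c - t))%:E) ->
  \int[mu]_t h (c - t) = \int[mu]_t h t.
Proof.
move=> mh ih; congr fine.
have mc : measurable_fun setT
    ((fun t => c - t) : measurableTypeR R -> measurableTypeR R).
  by apply: measurable_funB => //; exact: measurable_cst.
have := integral_pushforward mc (f := EFin \o h) (mu := mu) (D := setT).
rewrite preimage_setT => <- //; last exact/measurable_EFinP.
by apply: eq_measure_integral => A mA _; exact: lebesgue_measure_reflect.
Qed.

End LebesgueReflection.

(** * Integrable majorants from Schwartz seminorms *)

Section Decay.
Context {R : realType}.
Implicit Types (f g : cfun R) (z : R * R).

(** Integrable, with a polynomial as inverse, so that finitely many Schwartz seminorms bound a
    function by a multiple of it. *)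
Definition decay (t : R) : R := (1 + t ^+ 2)^-1.

Lemma decay_gt0 t : 0 < decay t.
Proof. by rewrite invr_gt0 ltr_pwDl// sqr_ge0. Qed.

Lemma decay_le1 t : decay t <= 1.
Proof. by rewrite invf_le1 ?lerDl ?sqr_ge0// ltr_pwDl// sqr_ge0. Qed.

Lemma integrable_decay : (@mu1 R).-integrable setT (EFin \o decay).
Proof.
have md : measurable_fun setT (decay : measurableTypeR R -> R).
  by apply: continuous_measurable_fun; exact: continuous_oneDsqrV.
apply/integrableP; split; first exact/measurable_EFinP.
under eq_integral do rewrite /= ger0_norm ?(ltW (decay_gt0 _))//.
rewrite ge0_symfun_integralT.
- rewrite (_ : [set x | _] = `[0, +oo[%classic); last first.
    by apply/seteqP; split => x/=; rewrite in_itv/= andbT.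
  by rewrite integral0y_oneDsqr -EFinM ltry.
- by move=> t; exact: ltW (decay_gt0 t).
- exact: continuous_oneDsqrV.
- by move=> t /=; rewrite /decay sqrrN.
Qed.

Definition decay2 (z : R * R) : R := decay z.1 * decay z.2.

Lemma integrable_decay2 : (@mu2 R).-integrable setT (EFin \o decay2).
Proof.
have md : measurable_fun setT (decay : measurableTypeR R -> R).
  by apply: continuous_measurable_fun; exact: continuous_oneDsqrV.
have md2 : measurable_fun setT
    (decay2 : measurableTypeR R * measurableTypeR R -> R).
  by apply: measurable_funM; apply: measurableT_comp.
apply/integrable12ltyP; first exact/measurable_EFinP.
pose I := \int[@mu1 R]_y decay y.
have iK : (\int[@mu1 R]_y (decay y)%:E = I%:E)%E.
  by rewrite fineK//; exact: integrable_fin_num integrable_decay.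
have E x : (\int[@mu1 R]_y `|(EFin \o decay2) (x, y)| = (I * decay x)%:E)%E.
  under eq_integral do
    rewrite /= ger0_norm ?mulr_ge0 ?(ltW (decay_gt0 _))// EFinM /=.
  rewrite ge0_integralZl//; last 3 first.
  - exact/measurable_EFinP.
  - by move=> t _; rewrite lee_fin ltW// decay_gt0.
  - by rewrite lee_fin ltW// decay_gt0.
  by rewrite iK muleC.
rewrite (_ : (fun x => _) = fun x => (I * decay x)%:E); last exact/funext.
have := integrable_fin_num measurableT (integrableZ_EFin I integrable_decay).
by rewrite fin_numElt => /andP[].
Qed.

(** Expanding (1 + x^2)(1 + y^2) gives four monomials with exponents 0 or 2, that is [a.*2] for a
    boolean [a]; each contributes at most [M], whence the 4. *)
Lemma weighted_decay f (M : R) z :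
  (forall a b : bool, weighted a.*2 b.*2 [::] f z <= M) ->
  Normc.normc (f z) <= 4 * M * decay2 z.
Proof.
move=> H.
rewrite /decay2 /decay -invfM.
rewrite -ler_pdivrMr ?invr_gt0 ?mulr_gt0 ?ltr_pwDl ?sqr_ge0// invrK.
have := lerD (lerD (H false false) (H true false))
  (lerD (H false true) (H true true)).
rewrite /weighted /= !Normc.normcM !normcR !expr0 !mulr1 !mul1r normr1 mul1r.
rewrite (_ : 1.*2 = 2)%N// (ger0_norm (mulr_ge0 (sqr_ge0 _) (sqr_ge0 _))).
by rewrite !(ger0_norm (sqr_ge0 _)); lra.
Qed.

Lemma schwartz_decay f : schwartz f ->
  exists2 K : R, 0 <= K & forall z, Normc.normc (f z) <= K * decay2 z.
Proof.
move=> Sf.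
have [K HK] : exists K : bool -> bool -> R,
    forall (a b : bool) z, weighted a.*2 b.*2 [::] f z <= K a b.
  have /choice[K HK] : forall ab : bool * bool, exists C, forall z,
      weighted ab.1.*2 ab.2.*2 [::] f z <= C.
    by move=> ab; case: Sf => _; exact.
  by exists (fun a b => K (a, b)) => a b; exact: (HK (a, b)).
have K0 a b : 0 <= K a b := le_trans (normc_ge0 _) (HK a b (0, 0)).
(* The sum of the four nonnegative bounds dominates each of them. *)
exists (4 * (K false false + K false true + (K true false + K true true))).
  by rewrite mulr_ge0// !addr_ge0.
move=> z; apply: weighted_decay => -[] [];
  by apply: le_trans (HK _ _ z) _; rewrite -subr_ge0;
  move: (K0 true true) (K0 true false) (K0 false true) (K0 false false); lra.
Qed.

End Decay.

(** * Integrals over vertical lines and their dependence on the abscissa *)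

Section SliceIntegral.
Context {R : realType}.
Implicit Types (f g : cfun R) (z : R * R) (x y : R).

Lemma schwartz_integrable f : schwartz f -> cintegrable (@mu2 R) f.
Proof.
move=> Sf; have [[cR cI] _] := Sf.1 [::]; have [K _ HK] := schwartz_decay Sf.
apply: (@cintegrable_dominated _ _ _ (@mu2 R) f (fun z => K * decay2 z)).
- exact: continuous_measurable_prod.
- exact: continuous_measurable_prod.
- exact: (integrableZ_EFin K integrable_decay2).
- exact: HK.
Qed.

Lemma schwartz_slice_decay f : schwartz f ->
  exists2 K : R, 0 <= K & forall z, Normc.normc (f z) <= K * decay z.2.
Proof.
move=> Sf; have [K K0 HK] := schwartz_decay Sf; exists K => // z.
apply: le_trans (HK z) _; rewrite ler_wpM2l// ler_piMl ?decay_le1//.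
exact: ltW (decay_gt0 _).
Qed.

Lemma schwartz_slice_integrable f x : schwartz f ->
  cintegrable (@mu1 R) (fun t => f (x, t)).
Proof.
move=> Sf; have [[cR cI] _] := Sf.1 [::].
have [K _ HK] := schwartz_slice_decay Sf.
have cpair : continuous (fun t : R => (x, t)).
  by move=> t; exact: (@cvg_pair _ _ _ _ (nbhs x) (nbhs t) _ _ _
    (cst x) id (cvg_cst x) cvg_id).
apply: (@cintegrable_dominated _ _ _ (@mu1 R) _ (fun t => K * decay t)).
- apply: continuous_measurable_fun => t.
  apply: (@continuous_comp _ _ _ (fun t : R => (x, t))
    (fun z => complex.Re (f z)));
    [exact: cpair|exact: cR].
- apply: continuous_measurable_fun => t.
  apply: (@continuous_comp _ _ _ (fun t : R => (x, t))
    (fun z => complex.Im (f z)));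
    [exact: cpair|exact: cI].
- exact: (integrableZ_EFin K integrable_decay).
- by move=> t; exact: (HK (x, t)).
Qed.

Definition slice_integral f x : R[i] := cintegral (@mu1 R) (fun t => f (x, t)).

Definition decay_mass : R := \int[@mu1 R]_t decay t.

Lemma normc_decay_integral (g : R -> R[i]) (K : R) : cintegrable (@mu1 R) g ->
  (forall t, Normc.normc (g t) <= K * decay t) ->
  Normc.normc (cintegral (@mu1 R) g) <= 2 * K * decay_mass.
Proof.
move=> ig gK; rewrite -mulrA -RintegralZl//; last exact: integrable_decay.
apply: normc_cintegral_le => //.
exact: (integrableZ_EFin K integrable_decay).
Qed.

(** The Taylor remainder in x at height t is at most [2 * K * h ^+ 2 * decay t], with [K] from the
    second x-derivative. Integrating in t keeps it quadratic in h. *)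
Lemma cderive_slice_integral f x : schwartz f ->
  cderive (slice_integral f) x (slice_integral (partial 0 f) x).
Proof.
move=> Sf; have S0 := schwartz_partial 0 Sf.
have [K K0 HK] := schwartz_slice_decay (schwartz_partial 0 S0).
apply: (@cderive_of_quadratic _ _ _ _ (2 * (2 * K) * decay_mass)) => h.
have i1 := schwartz_slice_integrable (x + h) Sf.
have i2 := schwartz_slice_integrable x Sf.
have i3 := cintegrableZ h%:C (schwartz_slice_integrable x S0).
rewrite /slice_integral -cintegralZ; last exact: schwartz_slice_integrable.
rewrite -cintegralB// -cintegralB//; last exact: cintegrableB.
have -> : 2 * (2 * K) * decay_mass * h ^+ 2 =
  2 * (2 * K * h ^+ 2) * decay_mass by ring.
apply: normc_decay_integral.
  by apply: cintegrableB => //; exact: cintegrableB.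
move=> t.
have -> : 2 * K * h ^+ 2 * decay t = 2 * (K * decay t) * h ^+ 2 by ring.
apply: (@ctaylor1 _ (fun s => f (s, t)) (fun s => partial 0 f (s, t))
  (fun s => partial 0 (partial 0 f) (s, t))) => r.
- exact: (@schwartz_pd _ f 0 (r, t)).
- exact: (@schwartz_pd _ (partial 0 f) 0 (r, t)).
- exact: (HK (r, t)).
Qed.

End SliceIntegral.

(** * Fourier and Wigner transforms *)

Section PartialFourier.
Context {R : realType}.
Implicit Types (f g : cfun R) (z : R * R) (x y u : R).

Lemma cintegral_reflect (c : R) (g : R -> R[i]) :
  cintegrable (@mu1 R) g -> cintegrable (@mu1 R) (fun t => g (c - t)) ->
  cintegral (@mu1 R) (fun t => g (c - t)) = cintegral (@mu1 R) g.
Proof.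
move=> [gR gI] [rR rI]; congr (_ +i* _).
  apply: (Rintegral_reflect (h := fun t => complex.Re (g t))) => //.
  by move/measurable_int/measurable_EFinP : gR.
apply: (Rintegral_reflect (h := fun t => complex.Im (g t))) => //.
by move/measurable_int/measurable_EFinP : gI.
Qed.

(* The reflection (x, t) |-> (x, x - t) preserves slice integrals but turns the
   derivative in x into the sum of both derivatives. *)
Lemma slice_integral_partial1 f x : schwartz f ->
  slice_integral (partial 1 f) x = 0.
Proof.
move=> Sf.
pose A z : R * R := (0 + z.1 * 1 + z.2 * 0, 0 + z.1 * 1 + z.2 * (-1)).
have AE z : A z = (z.1, z.1 - z.2).
  by rewrite /A !mulr1 mulr0 addr0 !add0r mulrN1.
have D0 : (1 : R) * -1 - 0 * 1 != 0.
  by rewrite mul0r subr0 mul1r oppr_eq0 oner_eq0.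
have SA g : schwartz g -> schwartz (g \o A) by exact: schwartz_affine.
have JA g y : schwartz g -> slice_integral (g \o A) y = slice_integral g y.
  move=> Sg; rewrite /slice_integral.
  have E : (fun t => (g \o A) (y, t)) = fun t => g (y, y - t).
    by apply/funext => t; rewrite /comp AE.
  have := schwartz_slice_integrable y (SA _ Sg); rewrite E => ig.
  apply: (cintegral_reflect (g := fun t => g (y, t))) => //.
  exact: schwartz_slice_integrable.
have S0 := schwartz_partial 0 Sf; have S1 := schwartz_partial 1 Sf.
have E : partial 0 (f \o A) = (fun z => partial 0 f z + partial 1 f z) \o A.
  apply/funext => z; apply: partial_pd.
  have [] := pd_affine 1 0 0 1 (-1) 0 z Sf.
  by rewrite !mul1r.
have H1 := cderive_slice_integral x (SA _ Sf).
rewrite (_ : slice_integral (f \o A) = slice_integral f) in H1; last first.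
  by apply/funext => y; exact: JA.
have := cderive_uniq H1 (cderive_slice_integral x Sf).
rewrite E JA; last exact: schwartzD.
rewrite /slice_integral cintegralD; try exact: schwartz_slice_integrable.
by rewrite -[RHS]addr0 => /addrI.
Qed.

Definition twist u f : cfun R := fun z => cexpi (- (z.2 * u)) * f z.

Lemma is_derive_oppM u (t : R) : is_derive t 1 (fun s => - (s * u)) (- u).
Proof.
by have := is_derive_affine 0 (- u) t; under eq_fun do rewrite add0r mulrN.
Qed.

Lemma pd_character u j z : pd j (fun z => cexpi (- (z.2 * u))) z
  ((if j == 0 then 0 else 0 +i* - u) * cexpi (- (z.2 * u))).
Proof.
move: j; apply: ord2P => /=.
  by rewrite mul0r; exact: (cderive_cst (cexpi (- (z.2 * u)))).
by apply: cderive_cexpi; exact: is_derive_oppM.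
Qed.

Lemma schwartz_twist u f : schwartz f -> schwartz (twist u f).
Proof.
apply: (schwartz_mul_unimodular (fun z => normc_cexpi _) (pd_character u)).
by move=> j g; exact: schwartzZ.
Qed.

Lemma partial_twist u j f z : schwartz f -> partial j (twist u f) z =
  twist u (fun z => (if j == 0 then 0 else 0 +i* - u) * f z + partial j f z) z.
Proof.
move=> Sf; apply: partial_pd.
apply: pd_ext; first exact: pdM (pd_character u j z) (schwartz_pd j z Sf).
by rewrite /twist; ring.
Qed.

(** The partial Fourier transform in the second variable: [z.1] is a parameter and [z.2] the
    frequency. *)
Definition pft f : cfun R := fun z => slice_integral (twist z.2 f) z.1.

Lemma pftE f x y :
  pft f (x, y) = cintegral (@mu1 R) (fun t => twist y f (x, t)).
Proof. by []. Qed.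

Lemma pftD f g z : schwartz f -> schwartz g ->
  pft (fun z => f z + g z) z = pft f z + pft g z.
Proof.
move=> Sf Sg; rewrite /pft /slice_integral -cintegralD.
- by congr cintegral; apply/funext => t; rewrite /twist mulrDr.
- by apply: schwartz_slice_integrable; exact: schwartz_twist.
- by apply: schwartz_slice_integrable; exact: schwartz_twist.
Qed.

Lemma pftZ c f z : schwartz f -> pft (fun z => c * f z) z = c * pft f z.
Proof.
move=> Sf; rewrite /pft /slice_integral -cintegralZ.
  by congr cintegral; apply/funext => t; rewrite /twist mulrCA.
by apply: schwartz_slice_integrable; exact: schwartz_twist.
Qed.

Lemma pft_Mop0 f : schwartz f -> Mop 0 (pft f) = pft (Mop 0 f).
Proof.
move=> Sf; apply/funext => z; rewrite /Mop /pft /slice_integral -cintegralZ.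
  by congr cintegral; apply/funext => t; rewrite /twist mulrCA.
by apply: schwartz_slice_integrable; exact: schwartz_twist.
Qed.

(** Integration by parts: the slice integral of the derivative of [twist z.2 f] vanishes, and the
    product rule splits it into the two sides. *)
Lemma pft_Mop1 f : schwartz f -> Mop 1 (pft f) = pft (Dop 1 f).
Proof.
move=> Sf; apply/funext => z; rewrite pftZ; last exact: schwartz_partial.
have := slice_integral_partial1 z.1 (schwartz_twist z.2 Sf).
rewrite (_ : partial 1 (twist z.2 f) =
    twist z.2 (fun w => (0 +i* - z.2) * f w + partial 1 f w)); last first.
  by apply/funext => w; rewrite partial_twist.
rewrite -/(pft (fun w => (0 +i* - z.2) * f w + partial 1 f w) z).
rewrite pftD ?pftZ//; last 2 first.
- exact: schwartzZ.
- exact: schwartz_partial.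
move=> /(canRL (addKr _)); rewrite addr0 => ->; rewrite /Mop /=.
by apply: complex_ext; rewrite ?cReM ?cImM ?cReN ?cImN ?cReM ?cImM /=; ring.
Qed.

Lemma pd0_pft f z : schwartz f -> pd 0 (pft f) z (pft (partial 0 f) z).
Proof.
move=> Sf; rewrite /pd /pft /=.
have := cderive_slice_integral z.1 (schwartz_twist z.2 Sf).
congr cderive; congr slice_integral; apply/funext => w.
by rewrite partial_twist//= /twist mul0r add0r.
Qed.

(** The second derivative of the character in the frequency has modulus t^2; this growth is absorbed
    by the decay of [Mop 1 (Mop 1 f)]. *)
Lemma pd1_pft f z : schwartz f ->
  pd 1 (pft f) z (pft (fun w => (0 -i* 1) * Mop 1 f w) z).
Proof.
move=> Sf; have S1 := schwartz_Mop 1 Sf.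
have [K K0 HK] := schwartz_slice_decay (schwartz_Mop 1 S1).
apply: (@cderive_of_quadratic _ _ _ _ (2 * 2 * K * decay_mass)) => h.
case: z => x y.
change (Normc.normc (pft f (x, y + h) - pft f (x, y) -
  h%:C * pft (fun w => (0 -i* 1) * Mop 1 f w) (x, y)) <=
  2 * 2 * K * decay_mass * h ^+ 2).
rewrite !pftE -cintegralZ; last first.
  by apply: schwartz_slice_integrable; apply: schwartz_twist; exact: schwartzZ.
have i1 := schwartz_slice_integrable x (schwartz_twist (y + h) Sf).
have i2 := schwartz_slice_integrable x (schwartz_twist y Sf).
have i3 := cintegrableZ h%:C
  (schwartz_slice_integrable x (schwartz_twist y (schwartzZ (0 -i* 1) S1))).
rewrite -cintegralB// -cintegralB//; last exact: cintegrableB.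
have -> : 2 * 2 * K * decay_mass * h ^+ 2 =
  2 * (2 * K * h ^+ 2) * decay_mass by ring.
apply: normc_decay_integral.
  by apply: cintegrableB => //; exact: cintegrableB.
move=> t; rewrite /twist /=.
rewrite (_ : _ - _ = (cexpi (- (t * (y + h))) - cexpi (- (t * y)) -
    h%:C * ((0 +i* - t) * cexpi (- (t * y)))) * f (x, t)); last first.
  rewrite /Mop /= (_ : (0 +i* - t) = (0 -i* 1) * t%:C :> R[i]); first ring.
  by apply: complex_ext; rewrite ?cReM ?cImM /=; ring.
rewrite Normc.normcM.
have T : Normc.normc (cexpi (- (t * (y + h))) - cexpi (- (t * y)) -
    h%:C * ((0 +i* - t) * cexpi (- (t * y)))) <= 2 * t ^+ 2 * h ^+ 2.
  apply: (@ctaylor1 _ (fun s => cexpi (- (t * s)))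
    (fun s => (0 +i* - t) * cexpi (- (t * s)))
    (fun s => (0 +i* - t) * ((0 +i* - t) * cexpi (- (t * s))))) => r.
  - apply: cderive_cexpi; under eq_fun do rewrite mulrC; exact: is_derive_oppM.
  - apply: cderiveZ; apply: cderive_cexpi.
    by under eq_fun do rewrite mulrC; exact: is_derive_oppM.
  - rewrite !Normc.normcM normc_cexpi mulr1 /= expr0n /= add0r sqrrN.
    by rewrite sqrtr_sqr -expr2 real_normK// num_real.
apply: le_trans (ler_wpM2r (normc_ge0 _) T) _.
have -> : 2 * t ^+ 2 * h ^+ 2 * Normc.normc (f (x, t)) =
  2 * h ^+ 2 * (t ^+ 2 * Normc.normc (f (x, t))) by ring.
have -> : 2 * K * h ^+ 2 * decay t = 2 * h ^+ 2 * (K * decay t) by ring.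
apply: ler_wpM2l; first by rewrite mulr_ge0// sqr_ge0.
have := HK (x, t); rewrite /Mop /= !Normc.normcM !normcR mulrA -expr2.
by rewrite real_normK// num_real.
Qed.

(** The image of S is stable since each generator passes inside [pft]: those of the first variable
    unchanged, those of the second exchanged up to a constant. *)
Lemma schwartz_pft f : schwartz f -> schwartz (pft f).
Proof.
move=> Sf.
apply: (@schwartz_coind _ (fun g => exists2 f, schwartz f & g = pft f)).
- move=> _ [{Sf}f Sf ->].
  have [K K0 HK] := schwartz_slice_decay Sf.
  exists (2 * K * decay_mass) => z; apply: normc_decay_integral.
    by apply: schwartz_slice_integrable; exact: schwartz_twist.
  move=> t; rewrite /twist Normc.normcM normc_cexpi mul1r.
  exact: (HK (z.1, t)).
- move=> _ j [{Sf}f Sf ->]; move: j; apply: ord2P.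
    by exists (Mop 0 f); [exact: schwartz_Mop|exact: pft_Mop0].
  by exists (Dop 1 f); [exact: schwartz_Dop|exact: pft_Mop1].
- move=> _ j [{Sf}f Sf ->]; move: j; apply: ord2P.
    exists (pft (partial 0 f)); last by move=> z; exact: pd0_pft.
    by eexists; last by []; exact: schwartz_partial.
  exists (pft (fun w => (0 -i* 1) * Mop 1 f w)); last first.
    by move=> z; exact: pd1_pft.
  by eexists; last by []; apply: schwartzZ; exact: schwartz_Mop.
- by exists f.
Qed.

Lemma pft_Dop0 f : schwartz f -> Dop 0 (pft f) = pft (Dop 0 f).
Proof.
move=> Sf; apply/funext => z; rewrite pftZ; last exact: schwartz_partial.
by rewrite /Dop (partial_pd (pd0_pft z Sf)).
Qed.

Lemma pft_Dop1 f z : schwartz f -> pft (Mop 1 f) z = - Dop 1 (pft f) z.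
Proof.
move=> Sf; have S1 := schwartz_Mop 1 Sf.
rewrite /Dop (partial_pd (pd1_pft z Sf)) pftZ// mulrA -mulNr -[LHS]mul1r.
by congr (_ * _); apply: complex_ext; rewrite ?cReN ?cImN ?cReM ?cImM /=; ring.
Qed.

End PartialFourier.

(** * The Fourier transform of the plane and convolution with sigma *)

Section Fourier.
Context {R : realType}.
Implicit Types (f g V : cfun R) (z zeta : R * R) (x y : R).

Definition swap f : cfun R := fun z => f (z.2, z.1).

Lemma schwartz_swap f : schwartz f -> schwartz (swap f).
Proof.
move=> Sf; have D0 : (0 : R) * 0 - 1 * 1 != 0.
  by rewrite mul0r mulr1 sub0r oppr_eq0 oner_eq0.
have := schwartz_affine 0 0 D0 Sf; congr schwartz; apply/funext => z.
by rewrite /comp !mulr0 !mulr1 addr0 !add0r addr0.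
Qed.

Lemma Dop1_swap f : Dop 1 (swap f) = swap (Dop 0 f).
Proof. by []. Qed.

Lemma cintegral_slices f : schwartz f ->
  cintegral (@mu2 R) f = cintegral (@mu1 R) (slice_integral f).
Proof.
move=> Sf; have [iR iI] := schwartz_integrable Sf.
congr (_ +i* _); rewrite /Rintegral; congr fine.
  rewrite -integral12_prod_meas1//; apply: eq_integral => x _.
  (* Slice integrals of Schwartz functions are finite, so the [fine] inside [Rintegral] loses
     nothing and Fubini applies. *)
  rewrite /fubini_F /= fineK//.
  by have [/(integrable_fin_num measurableT)] := schwartz_slice_integrable x Sf.
rewrite -integral12_prod_meas1//; apply: eq_integral => x _.
rewrite /fubini_F /= fineK//.
by have [_ /(integrable_fin_num measurableT)] := schwartz_slice_integrable x Sf.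
Qed.

Lemma schwartz_character zeta f : schwartz f ->
  schwartz (fun z => cexpi (- (z.1 * zeta.1 + z.2 * zeta.2)) * f z).
Proof.
move=> Sf.
have := schwartz_swap (schwartz_twist zeta.1
  (schwartz_swap (schwartz_twist zeta.2 Sf))).
congr schwartz; apply/funext => -[x y].
by rewrite /swap /twist /= opprD cexpiD mulrA.
Qed.

(** The character of the plane is a product of two characters of the line; Fubini then separates the
    variables, and [swap] lets [pft] act on the first one. *)
Lemma fourierE f : schwartz f -> fourier f = swap (pft (swap (pft f))).
Proof.
move=> Sf; apply/funext => -[u v].
rewrite /fourier cintegral_slices; last exact: (schwartz_character (u, v)).
congr cintegral; apply/funext => x.
rewrite /swap /twist /= /pft /slice_integral -cintegralZ; last first.
  by apply: schwartz_slice_integrable; exact: schwartz_twist.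
by congr cintegral; apply/funext => t; rewrite /twist /= opprD cexpiD mulrA.
Qed.

Lemma schwartz_fourier f : schwartz f -> schwartz (fourier f).
Proof.
move=> Sf; rewrite fourierE//.
by apply/schwartz_swap/schwartz_pft/schwartz_swap/schwartz_pft.
Qed.

Lemma fourierD f g zeta : schwartz f -> schwartz g ->
  fourier (fun z => f z + g z) zeta = fourier f zeta + fourier g zeta.
Proof.
move=> Sf Sg; rewrite /fourier -cintegralD.
- by congr cintegral; apply/funext => t; rewrite mulrDr.
- by apply: schwartz_integrable; exact: schwartz_character.
- by apply: schwartz_integrable; exact: schwartz_character.
Qed.

Lemma fourierZ c f zeta : schwartz f ->
  fourier (fun z => c * f z) zeta = c * fourier f zeta.
Proof.
move=> Sf; rewrite /fourier -cintegralZ.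
  by congr cintegral; apply/funext => t; rewrite mulrCA.
by apply: schwartz_integrable; exact: schwartz_character.
Qed.

Lemma fourier_Dop j f : schwartz f -> fourier (Dop j f) = Mop j (fourier f).
Proof.
move=> Sf; have S1 := schwartz_pft Sf; have S2 := schwartz_swap S1.
rewrite !fourierE//; last exact: schwartz_Dop.
move: j; apply: ord2P.
  by rewrite -pft_Dop0// -Dop1_swap -pft_Mop1.
rewrite -pft_Mop1// -[swap (Mop 1 _)]/(Mop 0 (swap (pft f))) -pft_Mop0//.
Qed.

Lemma fourier_Mop j f zeta : schwartz f ->
  fourier (Mop j f) zeta = - Dop j (fourier f) zeta.
Proof.
move=> Sf; have S1 := schwartz_pft Sf; have S2 := schwartz_swap S1.
rewrite !fourierE//; last exact: schwartz_Mop.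
move: j; apply: ord2P.
  rewrite -pft_Mop0//; exact: (pft_Dop1 (zeta.2, zeta.1) S2).
have -> : swap (pft (Mop 1 f)) = fun z => -1 * Dop 0 (swap (pft f)) z.
  by apply/funext => z; rewrite mulN1r; exact: (pft_Dop1 (z.2, z.1) Sf).
rewrite [LHS]pftZ; last exact: schwartz_Dop.
by rewrite mulN1r -pft_Dop0.
Qed.

Lemma cintegral_reflect2 f z : schwartz f ->
  schwartz (fun z' => f (z - z')) ->
  cintegral (@mu2 R) (fun z' => f (z - z')) = cintegral (@mu2 R) f.
Proof.
have int_slice g : schwartz g -> cintegrable (@mu1 R) (slice_integral g).
  move=> Sg.
  (* A slice integral is [pft g] at frequency 0, hence itself a slice of the Schwartz function
     [swap (pft g)]. *)
  have := schwartz_slice_integrable 0 (schwartz_swap (schwartz_pft Sg)).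
  congr cintegrable; apply/funext => x; congr cintegral; apply/funext => t.
  by rewrite /twist mulr0 oppr0 cexpi0 mul1r.
move=> Sf Sr; rewrite (cintegral_slices Sf) (cintegral_slices Sr).
have E : slice_integral (fun z' => f (z - z')) =
    fun x => slice_integral f (z.1 - x).
  apply/funext => x.
  apply: (@cintegral_reflect _ z.2 (fun t => f (z.1 - x, t))).
    exact: schwartz_slice_integrable.
  exact: schwartz_slice_integrable Sr.
rewrite E; apply: (@cintegral_reflect _ z.1 (slice_integral f)).
  exact: int_slice.
by rewrite -E; exact: int_slice.
Qed.

Lemma schwartz_reflect f z : schwartz f -> schwartz (fun z' => f (z - z')).
Proof.
move=> Sf; have D0 : (-1 : R) * -1 - 0 * 0 != 0.
  by rewrite mulr0 subr0 mulrNN mulr1 oner_eq0.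
have := schwartz_affine z.1 z.2 D0 Sf; congr schwartz; apply/funext => -[x y].
by rewrite /comp /= !mulr0 !mulrN1 !addr0; congr f; case: z.
Qed.

Definition fourier_const : R[i] := ((2 * pi) ^- 2)%:C.

(** The substitution z' -> z - z' turns the kernel of F^{-1} into that of F, up to a character in z.
    The pairing that defines convolution thus produces F V directly. *)
Lemma inv_fourier_reflect V z zeta : schwartz V ->
  inv_fourier (fun z' => V (z - z')) zeta =
  fourier_const * (cexpi (z.1 * zeta.1 + z.2 * zeta.2) * fourier V zeta).
Proof.
move=> SV; congr (_ * _).
have SG := schwartz_character zeta SV.
rewrite [in RHS]/fourier.
rewrite -(cintegral_reflect2 SG (schwartz_reflect z SG)).
rewrite -cintegralZ; last exact: schwartz_integrable (schwartz_reflect z SG).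
congr cintegral; apply/funext => -[x y] /=.
by rewrite mulrA -cexpiD; congr (cexpi _ * _); ring.
Qed.

Lemma inv_fourierE f z : inv_fourier f z = fourier_const * fourier f (- z).
Proof. by []. Qed.

Lemma schwartz_inv_fourier f : schwartz f -> schwartz (inv_fourier f).
Proof.
move=> Sf; apply: schwartzZ.
have := schwartz_reflect 0 (schwartz_fourier Sf).
by congr schwartz; apply/funext => z; rewrite sub0r.
Qed.

Lemma inv_fourierD f g z : schwartz f -> schwartz g ->
  inv_fourier (fun z => f z + g z) z = inv_fourier f z + inv_fourier g z.
Proof. by move=> Sf Sg; rewrite /inv_fourier fourierD// mulrDr. Qed.

Lemma inv_fourierZ c f z : schwartz f ->
  inv_fourier (fun z => c * f z) z = c * inv_fourier f z.
Proof. by move=> Sf; rewrite /inv_fourier fourierZ// mulrCA. Qed.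

Lemma inv_fourier_Dop j f z : schwartz f ->
  inv_fourier (Dop j f) z = - Mop j (inv_fourier f) z.
Proof.
move=> Sf; rewrite /Mop !inv_fourierE fourier_Dop// /Mop.
rewrite (_ : Defs.coord j (- z) = - Defs.coord j z); last first.
  by move: j; apply: ord2P.
by rewrite rmorphN /=; ring.
Qed.

Lemma inv_fourier_Mop j f : schwartz f ->
  inv_fourier (Mop j f) = Dop j (inv_fourier f).
Proof.
move=> Sf; apply/funext => z; rewrite inv_fourierE fourier_Mop//.
have SF := schwartz_fourier Sf.
suff E : partial j (inv_fourier f) z =
    fourier_const * (- partial j (fourier f) (- z)).
  by rewrite /Dop E -mulrN [in RHS]mulrCA.
apply: partial_pd; apply: pdZ.
have := schwartz_pd j (- z) SF; rewrite /pd.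
have -> : Defs.coord j (- z) = - Defs.coord j z by move: j; apply: ord2P.
move=> H.
have N : is_derive (Defs.coord j z) 1 (fun s : R => - s) (-1).
  have := is_derive_oppM 1 (Defs.coord j z).
  by under eq_fun do rewrite mulr1.
have := cderive_comp H N.
rewrite rmorphN /= rmorph1 mulN1r; congr cderive; apply/funext => t.
by congr fourier; move: j {H N}; apply: ord2P.
Qed.

(** Both sides are integrals over the frequency: after [inv_fourier_reflect], the character in z is
    exactly the kernel of F^{-1} at z. Stability of S under the phase is a hypothesis here,
    discharged by [schwartz_phase]. *)
Lemma convolution_sigmaE (P : mpoly.mpoly 2 R) V z :
  (forall f, schwartz f -> schwartz (fun zeta => cexpi (- mpoly.meval
     (tnth [tuple zeta.1; zeta.2]) P) * f zeta)) ->
  schwartz V ->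
  convolution (sigma P) V z = inv_fourier (fun zeta =>
    cexpi (- mpoly.meval (tnth [tuple zeta.1; zeta.2]) P) * fourier V zeta) z.
Proof.
move=> SP SV; rewrite /convolution /sigma /inv_fourier_distr /regular_distr.
have SVP := SP _ (schwartz_fourier SV).
rewrite inv_fourierE /fourier -cintegralZ; last first.
  by apply: schwartz_integrable; exact: (schwartz_character (- z) SVP).
congr cintegral; apply/funext => zeta; rewrite inv_fourier_reflect//.
set e := cexpi (- mpoly.meval _ _).
rewrite /= !mulrN -opprD opprK mulrCA; congr (_ * _).
by rewrite mulrCA [z.1 * _]mulrC [z.2 * _]mulrC.
Qed.

End Fourier.

(** * The Wigner transform and the four generators *)

Section Wigner.
Context {R : realType}.
Implicit Types (w : cfun R) (z : R * R).

Definition wigner_frame w : cfun R :=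
  fun z => w (z.1 + z.2 / 2, z.1 - z.2 / 2).

Lemma wigner_frameE w : wigner_frame w =
  w \o (fun z => (0 + z.1 * 1 + z.2 * 2^-1, 0 + z.1 * 1 + z.2 * - 2^-1)).
Proof. by apply/funext => z; rewrite /comp !mulr1 !add0r mulrN. Qed.

Lemma schwartz_wigner_frame w : schwartz w -> schwartz (wigner_frame w).
Proof. by move=> Sw; rewrite wigner_frameE; exact: schwartz_affine. Qed.

Lemma WigE w : Wig w = pft (wigner_frame w).
Proof. by []. Qed.

Lemma schwartz_Wig w : schwartz w -> schwartz (Wig w).
Proof.
by move=> Sw; rewrite WigE; apply/schwartz_pft/schwartz_wigner_frame.
Qed.

Lemma WigD w1 w2 z : schwartz w1 -> schwartz w2 ->
  Wig (fun z => w1 z + w2 z) z = Wig w1 z + Wig w2 z.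
Proof.
by move=> S1 S2; rewrite !WigE -pftD//; exact: schwartz_wigner_frame.
Qed.

Lemma WigZ c w z : schwartz w -> Wig (fun z => c * w z) z = c * Wig w z.
Proof. by move=> S1; rewrite !WigE -pftZ//; exact: schwartz_wigner_frame. Qed.

(** In the frame the two coordinates are x + t/2 and x - t/2, and [pft] sends multiplication by t to
    [- Dop 1]. *)
Lemma Wig_Mop w z : schwartz w ->
  Wig (Mop 0 w) z = Mop 0 (Wig w) z - 2^-1 * Dop 1 (Wig w) z /\
  Wig (Mop 1 w) z = Mop 0 (Wig w) z + 2^-1 * Dop 1 (Wig w) z.
Proof.
move=> Sw; have Sf := schwartz_wigner_frame Sw.
have S0 := schwartz_Mop 0 Sf; have S1 := schwartz_Mop 1 Sf.
have natC : (2^-1 : R[i]) = (2^-1 : R)%:C by rewrite fmorphV rmorph_nat.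
rewrite !WigE pft_Mop0// -[Dop 1 _ z]opprK -pft_Dop1// !mulrN opprK -mulNr.
rewrite -!pftZ// -!pftD//; try exact: schwartzZ.
split; congr (pft _ z); apply/funext => u;
  rewrite /wigner_frame /Mop /Defs.coord /= natC.
  by rewrite mulrA -rmorphM -mulrDl -rmorphD; congr (_%:C * _); field.
by rewrite -rmorphN mulrA -rmorphM -mulrDl -rmorphD; congr (_%:C * _); field.
Qed.

(** The derivatives of [wigner_frame w] in x and t are the sum and half the difference of those of
    [w]. Solving for the latter gives half the x-derivative plus or minus the t-derivative, and
    [pft] sends [Dop 1] to [Mop 1]. *)
Lemma Wig_Dop w z : schwartz w ->
  Wig (Dop 0 w) z = 2^-1 * Dop 0 (Wig w) z + Mop 1 (Wig w) z /\
  Wig (Dop 1 w) z = 2^-1 * Dop 0 (Wig w) z - Mop 1 (Wig w) z.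
Proof.
move=> Sw; have Sf := schwartz_wigner_frame Sw.
have S0 := schwartz_Dop 0 Sf; have S1 := schwartz_Dop 1 Sf.
have natC : (2^-1 : R[i]) = (2^-1 : R)%:C by rewrite fmorphV rmorph_nat.
rewrite !WigE pft_Dop0// pft_Mop1//.
rewrite -[X in _ /\ _ = _ + X]mulN1r -3?pftZ// -?pftD//; try exact: schwartzZ.
have P u : partial 0 (wigner_frame w) u =
    partial 0 w (u.1 + u.2 / 2, u.1 - u.2 / 2) +
    partial 1 w (u.1 + u.2 / 2, u.1 - u.2 / 2) /\
  partial 1 (wigner_frame w) u =
    (2^-1)%:C * (partial 0 w (u.1 + u.2 / 2, u.1 - u.2 / 2) -
    partial 1 w (u.1 + u.2 / 2, u.1 - u.2 / 2)).
  have [/partial_pd H0 /partial_pd H1] := pd_affine 1 2^-1 0 1 (- 2^-1) 0 u Sw.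
  rewrite wigner_frameE H0 H1 !mulr1 !add0r mulrN !mul1r.
  by split => //; rewrite rmorphN /=; ring.
split; congr (pft _ z); apply/funext => u; rewrite /wigner_frame /Dop /=;
  by have [-> ->] := P u; rewrite -natC; field.
Qed.

End Wigner.

(** * Intertwining with polynomial operators *)

Section Intertwining.
Context {R : realType}.
Implicit Types (f g : cfun R) (T : cop R).

Definition schwartz_linear T :=
  (forall f g z, schwartz f -> schwartz g ->
     T (fun z => f z + g z) z = T f z + T g z) /\
  (forall c f z, schwartz f -> T (fun z => c * f z) z = c * T f z).

(** Stability of S under [X] is included so that the relation composes: the next factor must again
    be applied to a Schwartz function. *)
Definition intertwines T (X Y : cop R) := forall f, schwartz f ->
  schwartz (X f) /\ T (X f) = Y (T f).

Lemma intertwines_monomial T n (X Y : n.-tuple (cop R)) (m : mpoly.multinom n) :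
  (forall i, intertwines T (tnth X i) (tnth Y i)) ->
  intertwines T (monomial_op m X) (monomial_op m Y).
Proof.
move=> XY; rewrite /monomial_op.
apply: (big_ind2 (intertwines T)) => [f Sf|X1 Y1 X2 Y2 H1 H2 f Sf|i _ f Sf].
- by split.
- have [S2 E2] := H2 f Sf; have [S1 E1] := H1 _ S2.
  by split => //=; rewrite E1 E2.
- elim: (mpoly.fun_of_multinom m i) => [|k [IS IE]] /=; first by split.
  by have [S1 E1] := XY i _ IS; split => //; rewrite E1 IE.
Qed.

Lemma intertwines_poly_op T n (p : mpoly.mpoly n R[i])
    (X Y : n.-tuple (cop R)) :
  schwartz_linear T ->
  (forall i, intertwines T (tnth X i) (tnth Y i)) ->
  intertwines T (poly_op p X) (poly_op p Y).
Proof.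
move=> [TD TZ] XY f Sf; rewrite /poly_op.
have M m := intertwines_monomial m XY Sf.
elim: (mpoly.msupp p) => [|m s [IS IE]].
  (* The empty sum is written [0 * f], so that homogeneity of [T] gives T 0 = 0. *)
  have E0 : (fun z => \sum_(m <- [::]) mpoly.mcoeff m p * monomial_op m X f z) =
      fun z => 0 * f z by apply/funext => z; rewrite big_nil mul0r.
  rewrite E0; split; first exact: schwartzZ.
  by apply/funext => z; rewrite TZ// mul0r big_nil.
have [Sm Em] := M m.
have E : (fun z => \sum_(k <- m :: s) mpoly.mcoeff k p * monomial_op k X f z) =
    fun z => mpoly.mcoeff m p * monomial_op m X f z +
      \sum_(k <- s) mpoly.mcoeff k p * monomial_op k X f z.
  by apply/funext => z; rewrite big_cons.
rewrite E; split; first by apply: schwartzD => //; exact: schwartzZ.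
apply/funext => z; rewrite TD//; last exact: schwartzZ.
by rewrite TZ// IE Em big_cons.
Qed.

End Intertwining.

(** * Polynomial symbols and the phase *)

Section PolynomialSymbol.
Context {R : realType}.
Implicit Types (f g : cfun R) (z : R * R) (P : mpoly.mpoly 2 R).

Definition symbol P z : R := mpoly.meval (tnth [tuple z.1; z.2]) P.

Local Notation expo m j := (mpoly.fun_of_multinom m j).

Lemma symbolE P z : symbol P z =
  \sum_(m <- mpoly.msupp P) mpoly.mcoeff m P *
    (z.1 ^+ expo m 0 * z.2 ^+ expo m 1).
Proof.
rewrite /symbol mpoly.mevalE; apply: eq_bigr => m _.
rewrite 2!big_ord_recl big_ord0 mulr1.
congr (_ * (_ ^+ (expo m _) * _ ^+ (expo m _))); exact: val_inj.
Qed.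

Lemma symbol_mderiv P j z : symbol (mpoly.mderiv j P) z =
  \sum_(m <- mpoly.msupp P) mpoly.mcoeff m P *
    (if j == 0 then (expo m 0)%:R * (z.1 ^+ (expo m 0).-1 * z.2 ^+ expo m 1)
     else (expo m 1)%:R * (z.1 ^+ expo m 0 * z.2 ^+ (expo m 1).-1)).
Proof.
rewrite /symbol /mpoly.mderiv.
rewrite (big_morph _ (mpoly.mevalD _) (mpoly.meval0 _)).
apply: eq_bigr => m _ /=.
rewrite mpoly.mevalZ mpoly.mevalX 2!big_ord_recl big_ord0 mulr1.
rewrite [(expo m j)%:R * _]mulrC -mulrA; congr (_ * _).
have -> : lift ord0 ord0 = 1 :> 'I_2 by exact: val_inj.
have -> : ord0 = 0 :> 'I_2 by exact: val_inj.
rewrite !mpoly.mnmBE !mpoly.mnm1E.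
by move: j; apply: ord2P; rewrite /= ?subn0 ?subn1.
Qed.

Lemma pd_symbol P j z : pd j (fun z => (symbol P z)%:C) z
  (symbol (mpoly.mderiv j P) z)%:C.
Proof.
rewrite symbol_mderiv.
have -> : (fun z => (symbol P z)%:C) = fun z =>
    (\sum_(m <- mpoly.msupp P) mpoly.mcoeff m P *
      (z.1 ^+ expo m 0 * z.2 ^+ expo m 1))%:C.
  by apply/funext => w; rewrite symbolE.
elim: (mpoly.msupp P) => [|m s IH].
  by under [X in pd _ X]eq_fun do rewrite big_nil;
    rewrite big_nil; exact: cderive_cst.
under [X in pd _ X]eq_fun do rewrite big_cons rmorphD rmorphM.
rewrite big_cons rmorphD rmorphM; apply: pdD IH; apply: pdZ.
apply: pd_ext; first exact: pd_monomial.
by case: (j == 0); rewrite [RHS]rmorphM; congr (_ * _); rewrite rmorph_nat.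
Qed.

(** Identifies multiplication by a polynomial as a [poly_op], so that the intertwining lemma also
    governs symbols. *)
Lemma poly_op_Mop P f z :
  poly_op (mpoly.map_mpoly (real_complex R) P) [tuple Mop 0; Mop 1] f z =
  (symbol P z)%:C * f z.
Proof.
have inj : injective (real_complex R) by move=> a b [].
(* An injective coefficient map preserves the support only up to the order of its list. *)
rewrite symbolE /poly_op (perm_big _ (mpoly.msupp_map_mpoly P inj)).
rewrite rmorph_sum mulr_suml; apply: eq_bigr => m _.
rewrite mpoly.mcoeff_map_mpoly !rmorphM -!mulrA; congr (_ * _).
rewrite /monomial_op 2!big_ord_recl big_ord0 /= !iter_Mop /=.
rewrite -!rmorphXn.
have -> : lift ord0 ord0 = 1 :> 'I_2 by exact: val_inj.
by have -> : ord0 = 0 :> 'I_2 by exact: val_inj.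
Qed.

Lemma schwartz_symbol P f : schwartz f ->
  schwartz (fun z => (symbol P z)%:C * f z).
Proof.
move=> Sf.
rewrite (_ : (fun z => _) =
    poly_op (mpoly.map_mpoly (real_complex R) P) [tuple Mop 0; Mop 1] f).
  (* With the identity as [T], intertwining says that S is stable under the polynomial operator. *)
  have [] // := @intertwines_poly_op R id _ (mpoly.map_mpoly (real_complex R) P)
    [tuple Mop 0; Mop 1] [tuple Mop 0; Mop 1] _ _ f Sf.
  by apply: ord2P => g Sg; split => //; exact: schwartz_Mop.
by apply/funext => z; rewrite poly_op_Mop.
Qed.

Lemma grad_op_inv_fourier P j f z : schwartz f ->
  grad_op P j (inv_fourier f) z =
  inv_fourier (fun zeta => (symbol (mpoly.mderiv j P) zeta)%:C * f zeta) z.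
Proof.
move=> Sf; rewrite /grad_op.
(* With F^{-1} as [T], which carries [Mop j] to [Dop j], the symbol becomes the operator with the
   same polynomial. *)
have [|| _ <-] := @intertwines_poly_op R (@inv_fourier R) _
  (mpoly.map_mpoly (real_complex R) (mpoly.mderiv j P))
  [tuple Mop 0; Mop 1] [tuple Dop 0; Dop 1] _ _ f Sf.
- by split=> *; [exact: inv_fourierD|exact: inv_fourierZ].
- apply: ord2P => g Sg; split;
    by [exact: schwartz_Mop|exact: inv_fourier_Mop].
- by congr (inv_fourier _ z); apply/funext => zeta; exact: poly_op_Mop.
Qed.

Definition phase P z : R[i] := cexpi (- symbol P z).

Lemma pd_phase P j z :
  pd j (phase P) z ((0 +i* - symbol (mpoly.mderiv j P) z) * phase P z).
Proof.
have [H _] := pd_symbol P j z.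
have N : is_derive (Defs.coord j z) (1 : R)
  (fun t => - symbol P (set_coord j z t)) (- symbol (mpoly.mderiv j P) z)
  := is_deriveN H.
by have := cderive_cexpi N; rewrite set_coord_coord.
Qed.

Lemma schwartz_phase P f : schwartz f -> schwartz (fun z => phase P z * f z).
Proof.
apply: (schwartz_mul_unimodular (fun z => normc_cexpi _) (pd_phase P)).
move=> j g Sg.
rewrite (_ : (fun z => _) = fun z =>
    (0 -i* 1) * ((symbol (mpoly.mderiv j P) z)%:C * g z)).
  by apply: schwartzZ; exact: schwartz_symbol.
apply/funext => z; rewrite mulrA; congr (_ * _).
by apply: complex_ext; rewrite ?cReM ?cImM /=; ring.
Qed.

End PolynomialSymbol.

(** * Temperedness of sigma and its Fourier multiplier *)

Section TemperedSymbol.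
Context {R : realType}.
Implicit Types (f g h V w : cfun R) (z zeta : R * R) (P : mpoly.mpoly 2 R).

Definition decay2_mass : R := \int[@mu2 R]_z decay2 z.

Lemma normc_decay2_integral f (K : R) : schwartz f ->
  (forall z, Normc.normc (f z) <= K * decay2 z) ->
  Normc.normc (cintegral (@mu2 R) f) <= 2 * K * decay2_mass.
Proof.
move=> Sf fK; rewrite -mulrA -RintegralZl//; last exact: integrable_decay2.
apply: normc_cintegral_le => //; first exact: schwartz_integrable.
exact: (integrableZ_EFin K integrable_decay2).
Qed.

Lemma iter_Dop j a f : schwartz f -> schwartz (iter a (Dop j) f) /\
  iter a (Dop j) f = fun z => (0 -i* 1) ^+ a * iter a (partial j) f z.
Proof.
move=> Sf; elim: a => [|a [IS IE]].
  by split => //=; apply/funext => z; rewrite mul1r.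
have Sp : schwartz (iter a (partial j) f).
  by elim: (a) => //= b; exact: schwartz_partial.
split; first exact: schwartz_Dop.
apply/funext => z; rewrite iterS IE /Dop.
rewrite (partial_pd (pdZ _ (schwartz_pd j z Sp))).
by rewrite exprS mulrA.
Qed.

Lemma fourier_iter_Dop j a f : schwartz f ->
  fourier (iter a (Dop j) f) = iter a (Mop j) (fourier f).
Proof.
move=> Sf; elim: a => //= a <-.
by rewrite fourier_Dop//; have [] := iter_Dop j a Sf.
Qed.

(** Weights on F f are derivatives of f under the integral, whose modulus is at most the integral of
    the modulus; the 4 is from [weighted_decay], the 2 from bounding components separately. *)
Lemma weighted_fourier f (M : R) (a b : nat) zeta : schwartz f ->
  (forall (c d : bool) z,
    weighted c.*2 d.*2 (nseq a 0 ++ nseq b 1) f z <= M) ->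
  weighted a b [::] (fourier f) zeta <= 2 * (4 * M) * decay2_mass.
Proof.
move=> Sf fM.
have [S1 E1] := iter_Dop 1 b Sf.
have [S0 E0] := iter_Dop 0 a S1.
rewrite weightedE -fourier_iter_Dop// -fourier_iter_Dop//.
apply: normc_decay2_integral; first exact: schwartz_character.
move=> z; rewrite Normc.normcM normc_cexpi mul1r.
apply: weighted_decay => c d; apply: le_trans (fM c d z).
have normcX n : Normc.normc ((0 -i* 1 : R[i]) ^+ n) = 1.
  elim: n => [|n IH]; first by rewrite expr0 Normc.normc1.
  by rewrite exprS Normc.normcM IH mulr1 /= expr0n add0r sqrrN expr1n sqrtr1.
have Sp : schwartz (iter b (partial 1) f).
  by elim: (b) => //= k; exact: schwartz_partial.
have E : iter a (Dop 0) (iter b (Dop 1) f) = fun z =>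
    (0 -i* 1) ^+ b * ((0 -i* 1) ^+ a * partials (nseq a 0 ++ nseq b 1) f z).
  rewrite E1; have [Sa Ea] := iter_Dop 0 a Sp.
  have -> : partials (nseq a 0 ++ nseq b 1) f =
      iter a (partial 0) (iter b (partial 1) f).
    rewrite /partials foldr_cat.
    have F k (j : 'I_2) g :
        foldr (@partial R) g (nseq k j) = iter k (partial j) g.
      by elim: k => //= k ->.
    by rewrite !F.
  have DZ k (c0 : R[i]) g : schwartz g ->
      iter k (Dop 0) (fun z => c0 * g z) = fun z => c0 * iter k (Dop 0) g z.
    move=> Sg; elim: k => //= k ->; apply/funext => u.
    have [Sk _] := iter_Dop 0 k Sg.
    by rewrite {1}/Dop (partial_pd (pdZ _ (schwartz_pd 0 u Sk))) mulrCA.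
  by rewrite DZ// Ea.
by rewrite /weighted E /= !Normc.normcM !normcX !mul1r.
Qed.

Lemma sigmaE P f :
  sigma P f =
  cintegral (@mu2 R) (fun zeta => phase P zeta * inv_fourier f zeta).
Proof. by []. Qed.

(** The phase has modulus 1, so it is enough to bound the integral of |F^{-1} f| by finitely many
    seminorms of f. *)
Lemma tempered_sigma P : tempered (sigma P).
Proof.
split=> [c f g Sf Sg|].
  rewrite !sigmaE.
  have If := schwartz_integrable (schwartz_phase P (schwartz_inv_fourier Sf)).
  have Ig := schwartz_integrable (schwartz_phase P (schwartz_inv_fourier Sg)).
  rewrite -cintegralZ// -cintegralD//; last exact: cintegrableZ.
  congr cintegral; apply/funext => zeta.
  by rewrite inv_fourierD ?inv_fourierZ//; [ring|exact: schwartzZ].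
pose k : R := Normc.normc (@fourier_const R).
(* Decay of F f asks for weights of exponent 0 or 2 in each frequency, hence for words of at most 4
   derivatives of f with weights at most 2. The constant nests the bounds of
   [normc_decay2_integral], [weighted_decay] and [weighted_fourier], with [k] from F^{-1}. *)
exists 4%N, (2 * (k * (4 * (2 * 4 * decay2_mass))) * decay2_mass) => f M Sf fM.
rewrite sigmaE.
have -> : 2 * (k * (4 * (2 * 4 * decay2_mass))) * decay2_mass * M =
  2 * (k * (4 * (2 * (4 * M) * decay2_mass))) * decay2_mass by ring.
apply: normc_decay2_integral.
  by apply: schwartz_phase; exact: schwartz_inv_fourier.
move=> zeta; rewrite Normc.normcM normc_cexpi mul1r inv_fourierE Normc.normcM.
rewrite -mulrA ler_wpM2l ?normc_ge0//.
have -> : decay2 zeta = decay2 (- zeta) by rewrite /decay2 /decay /= !sqrrN.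
apply: weighted_decay => a b; apply: weighted_fourier => // c d z.
by apply: fM; case: a b c d => [] [] [] [].
Qed.

(** The Fourier multiplier of symbol e^{-iP}, which is how convolution with sigma acts on S. *)
Definition phase_filter P V : cfun R :=
  inv_fourier (fun zeta => phase P zeta * fourier V zeta).

Lemma schwartz_phase_filter P V : schwartz V -> schwartz (phase_filter P V).
Proof. by move=> /schwartz_fourier/(schwartz_phase P)/schwartz_inv_fourier. Qed.

Lemma convolution_sigma P V : schwartz V ->
  convolution (sigma P) V = phase_filter P V.
Proof.
move=> SV; apply/funext => z; apply: convolution_sigmaE => // f.
exact: schwartz_phase.
Qed.

Lemma phase_filterD P V w z : schwartz V -> schwartz w ->
  phase_filter P (fun z => V z + w z) z =
  phase_filter P V z + phase_filter P w z.
Proof.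
move=> SV Sw; rewrite /phase_filter -inv_fourierD.
- congr (inv_fourier _ z); apply/funext => zeta.
  by rewrite (fourierD zeta SV Sw) mulrDr.
- by apply: schwartz_phase; exact: schwartz_fourier.
- by apply: schwartz_phase; exact: schwartz_fourier.
Qed.

Lemma phase_filterZ P c V z : schwartz V ->
  phase_filter P (fun z => c * V z) z = c * phase_filter P V z.
Proof.
move=> SV; rewrite /phase_filter -inv_fourierZ.
  congr (inv_fourier _ z); apply/funext => zeta.
  by rewrite (fourierZ c zeta SV) mulrCA.
by apply: schwartz_phase; exact: schwartz_fourier.
Qed.

Lemma phase_filter_Dop P j V : schwartz V ->
  phase_filter P (Dop j V) = Dop j (phase_filter P V).
Proof.
move=> SV; rewrite /phase_filter -inv_fourier_Mop; last first.
  by apply: schwartz_phase; exact: schwartz_fourier.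
congr inv_fourier; apply/funext => zeta.
by rewrite (fourier_Dop j SV) /Mop mulrCA.
Qed.

(** The source of [P_1] and [P_2]: F turns [Mop j] into [- Dop j], moving this past e^{-iP} leaves
    the extra term - d_j P, and F^{-1} turns the two terms into [Mop j] and [- grad_op P j]. *)
Lemma phase_filter_Mop P j V z : schwartz V ->
  phase_filter P (Mop j V) z =
  Mop j (phase_filter P V) z - grad_op P j (phase_filter P V) z.
Proof.
move=> SV; have SF := schwartz_fourier SV; have SP := schwartz_phase P SF.
rewrite /phase_filter grad_op_inv_fourier//.
rewrite -[Mop j _ z]opprK -inv_fourier_Dop//.
have Sd := schwartz_Dop j SP.
have Ss := schwartz_symbol (mpoly.mderiv j P) SP.
rewrite -opprD -(inv_fourierD z Sd Ss) -mulN1r.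
rewrite -(inv_fourierZ (-1) z (schwartzD Sd Ss)).
congr (inv_fourier _ z); apply/funext => zeta.
rewrite (fourier_Mop j zeta SV) /Dop.
rewrite (partial_pd (pdM (pd_phase P j zeta) (schwartz_pd j zeta SF))).
set s := symbol _ _.
have -> : (0 +i* - s) = (0 -i* 1) * s%:C :> R[i].
  by apply: complex_ext; rewrite ?cReM ?cImM /=; ring.
have i2 : (0 -i* 1) * (0 -i* 1) = -1 :> R[i].
  by apply: complex_ext; rewrite ?cReM ?cImM ?cReN ?cImN /=; ring.
(* With -i abstracted to [e], what remains is a polynomial identity modulo [e * e + 1], with
   cofactor [q * p * v]. *)
move: (0 -i* 1) i2 => e i2.
move: (phase P zeta) (fourier V zeta) (partial j (fourier V) zeta) s%:C.
move=> p v v' q; apply/eqP; rewrite -subr_eq0; apply/eqP.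
by transitivity ((e * e + 1) * (q * p * v)); [ring|rewrite i2 addNr mul0r].
Qed.

End TemperedSymbol.

Theorem theorem3p2 (R : realType) (B : mpoly.mpoly 4 R[i]) (P : mpoly.mpoly 2 R) :
  let Q (w : cfun R) : cfun R := convolution (sigma P) (Wig w) in
  tempered (sigma P) /\
  forall w : cfun R, schwartz w ->
    smooth (Q w) /\
    Q (poly_op B (standard_ops R) w) = poly_op B (twisted_ops P) (Q w).
Proof.
move=> Q; split; first exact: tempered_sigma.
pose T (w : cfun R) := phase_filter P (Wig w).
have QT w : schwartz w -> Q w = T w.
  by move=> Sw; apply: convolution_sigma; exact: schwartz_Wig.
have linT : schwartz_linear T.
  split=> [f g z Sf Sg|c f z Sf]; have SW := schwartz_Wig Sf.
    rewrite /T -(phase_filterD P z SW (schwartz_Wig Sg)).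
    by congr (phase_filter P _ z); apply/funext => u; rewrite (WigD u Sf Sg).
  rewrite /T -(phase_filterZ P c z SW).
  by congr (phase_filter P _ z); apply/funext => u; rewrite (WigZ c u Sf).
(* In each case the rule for [Wig] is followed by the rule for the multiplier. Differences are
   written with scalars [- 2^-1] or [-1], so that additivity and homogeneity suffice. *)
have genT i : intertwines T (tnth (standard_ops R) i) (tnth (twisted_ops P) i).
  move=> f Sf; have SW := schwartz_Wig Sf.
  have SM j := schwartz_Mop j SW; have SD j := schwartz_Dop j SW.
  move: i => [[|[|[|[|//]]]] i]; rewrite !(tnth_nth id) /=.
  - split; first exact: schwartz_Mop.
    apply/funext => z; rewrite /T.
    have -> : Wig (Mop 0 f) =
        fun z => Mop 0 (Wig f) z + - 2^-1 * Dop 1 (Wig f) z.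
      by apply/funext => u; have [-> _] := Wig_Mop u Sf; rewrite mulNr.
    rewrite (phase_filterD P z (SM 0) (schwartzZ _ (SD 1))).
    rewrite (phase_filterZ P _ z (SD 1)) (phase_filter_Mop P 0 z SW).
    by rewrite (phase_filter_Dop P 1 SW) mulNr addrAC.
  - split; first exact: schwartz_Mop.
    apply/funext => z; rewrite /T.
    have -> : Wig (Mop 1 f) = fun z => Mop 0 (Wig f) z + 2^-1 * Dop 1 (Wig f) z.
      by apply/funext => u; have [_ ->] := Wig_Mop u Sf.
    rewrite (phase_filterD P z (SM 0) (schwartzZ _ (SD 1))).
    rewrite (phase_filterZ P _ z (SD 1)) (phase_filter_Mop P 0 z SW).
    by rewrite (phase_filter_Dop P 1 SW) addrAC.
  - split; first exact: schwartz_Dop.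
    apply/funext => z; rewrite /T.
    have -> : Wig (Dop 0 f) = fun z => 2^-1 * Dop 0 (Wig f) z + Mop 1 (Wig f) z.
      by apply/funext => u; have [-> _] := Wig_Dop u Sf.
    rewrite (phase_filterD P z (schwartzZ _ (SD 0)) (SM 1)).
    rewrite (phase_filterZ P _ z (SD 0)) (phase_filter_Mop P 1 z SW).
    by rewrite (phase_filter_Dop P 0 SW) addrA.
  - split; first exact: schwartz_Dop.
    apply/funext => z; rewrite /T.
    have -> : Wig (Dop 1 f) =
        fun z => 2^-1 * Dop 0 (Wig f) z + -1 * Mop 1 (Wig f) z.
      by apply/funext => u; have [_ ->] := Wig_Dop u Sf; rewrite mulN1r.
    rewrite (phase_filterD P z (schwartzZ _ (SD 0)) (schwartzZ _ (SM 1))).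
    rewrite (phase_filterZ P _ z (SD 0)) (phase_filterZ P _ z (SM 1)).
    rewrite (phase_filter_Mop P 1 z SW) (phase_filter_Dop P 0 SW).
    by rewrite mulN1r opprB addrA addrAC.
move=> w Sw; rewrite (QT w Sw).
split; first by have [] := schwartz_phase_filter P (schwartz_Wig Sw).
(* [SB] says that B applied to [w] is Schwartz, which allows [Q] to be replaced by [T] on the
   left-hand side too. *)
have [SB <-] := intertwines_poly_op B linT genT Sw.
exact: QT.
Qed.
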